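(* Let $\omega'$ be a locally conformally Kähler (l.c.k.) structure on the Inoue surface $S:=S^{(+)}_{N,p,q,r;t}$. Then the corresponding flat line bundle $L'$ to $\omega'$ must be the canonical line bundle $K$ of $S$ (i.e. the holomorphic line bundle defined by $L'$ is isomorphic to $K$).
   Context: An l.c.k. structure on a complex manifold is the fundamental $2$-form $\omega$ of a Hermitian metric such that $d\omega=\eta\wedge\omega$ for some $d$-closed real $1$-form $\eta$ (the Lee form). Its corresponding flat line bundle is the real flat line bundle $L$ with locally constant transition functions $e^{-\lambda_{ij}}$ where, on a suitable open cover $\{U_i\}$, $\eta|_{U_i}=df_i$ and $\lambda_{ij}=f_i-f_j$ is constant on $U_i\cap U_j$. Via $\mathbb{R}^*\subset\mathcal{O}^*$, a real flat line bundle defines a holomorphic line bundle. Inoue surface $S^{(+)}_{N,p,q,r;t}$, $t\in\mathbb{C}$: let $\mathbb{H}$ be the upper half plane with coordinate $w$ and $\mathbb{C}$ have coordinate $z$. Let $N=(n_{ij})\in SL(2,\mathbb{Z})$ have real eigenvalues $\alpha>1$ and $1/\alpha$, with real eigenvectors $(a_1,a_2)$ and $(b_1,b_2)$ for $\alpha$ and $1/\alpha$ respectively; let $p,q,r$ be integers with $r\neq0$, and let $(c_1,c_2)$ be the real solution of $(c_1,c_2)=(c_1,c_2)N^{t}+(e_1,e_2)+\frac{b_1a_2-b_2a_1}{r}(p,q)$, where $N^t$ is the transpose of $N$ and $e_i=\frac12 n_{i1}(n_{i1}-1)a_1b_1+\frac12 n_{i2}(n_{i2}-1)a_2b_2+n_{i1}n_{i2}b_1a_2$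 for $i=1,2$. Then $S^{(+)}_{N,p,q,r;t}$ is the quotient of $\mathbb{H}\times\mathbb{C}$ by the group generated by $\phi_0(w,z)=(\alpha w,z+t)$, $\phi_i(w,z)=(w+a_i,\,z+b_iw+c_i)$ for $i=1,2$, and $\phi_3(w,z)=(w,\,z+\frac{b_1a_2-b_2a_1}{r})$, which acts freely and properly discontinuously with compact quotient. *)

(* Defs.v *)
From HB Require Import structures.
From mathcomp Require Import all_boot all_order all_algebra.
From mathcomp Require Import generic_quotient complex.
From mathcomp Require Import all_classical all_reals all_analysis.
Set Implicit Arguments.
Unset Strict Implicit.
Unset Printing Implicit Defensive.
Import Order.TTheory GRing.Theory Num.Theory numFieldNormedType.Exports.
Local Open Scope classical_set_scope.
Local Open Scope complex_scope.
Local Open Scope quotient_scope.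
Local Open Scope ring_scope.

(* The complex numbers, seen through [numFieldType] so that ['rV[Cx R]_2] is
   found to be a normed module over [Cx R]: [differentiable] between such
   spaces is then complex differentiability and ['J] the holomorphic Jacobian
   matrix. *)
Definition Cx (R : realType) : numFieldType := R[i].
Notation "'C2' R" := 'rV[Cx R]_2 (at level 8, R at level 2).

(* * Real calculus on open subsets of C^2 *)

Section RealCalculus.
Variable R : realType.
Implicit Types (W : set (C2 R)) (F : C2 R -> R) (x u : C2 R).

Definition real_line F x u : R -> R := fun s => F (x + (s%:C : Cx R) *: u).

(* [u] is a real tangent vector: one differentiates along real multiples of
   [u] only. *)
Definition real_derive F x u : R := derive1 (real_line F x u) 0.

Fixpoint Ck_on (n : nat) W F : Prop :=
  (forall x, W x -> {for x, continuous F}) /\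
  (if n is m.+1 then
     forall u, (forall x, W x -> derivable (real_line F x u) 0 1) /\
               Ck_on m W (fun x => real_derive F x u)
   else True).

Definition smooth_on W F : Prop := forall n, Ck_on n W F.

End RealCalculus.

(* * Complex surfaces given by an atlas *)

(* [param] is the inverse of the coordinate map [coord : dom -> coord @` dom];
   its values outside [coord @` dom] are irrelevant. *)
Record chart (R : realType) (M : topologicalType) := Chart {
  dom : set M;
  coord : M -> C2 R;
  param : C2 R -> M }.

Section ComplexSurface.
Variables (R : realType) (M : topologicalType) (A : set (chart R M)).
Implicit Types (c : chart R M) (x u v w : C2 R) (U : set M).

Definition change c c' : C2 R -> C2 R := coord c' \o param c.

Definition holomorphic_on U (f : M -> Cx R) : Prop :=
  forall c p, A c -> dom c p -> U p -> differentiable (f \o param c) (coord c p).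

Definition smooth_fun_on U (f : M -> R) : Prop :=
  forall c, A c -> smooth_on (coord c @` (dom c `&` U)) (f \o param c).

(* A covariant tensor is given by its expression in each chart: [eta c x u] is
   its value at the point of coordinates [x], on the real tangent vector of
   components [u]. *)
Definition tensor1 := chart R M -> C2 R -> C2 R -> R.
Definition tensor2 := chart R M -> C2 R -> C2 R -> C2 R -> R.

Definition real_linear (l : C2 R -> R) : Prop :=
  forall (s : R) u v, l ((s%:C : Cx R) *: u + v) = s * l u + l v.

Record is_one_form (eta : tensor1) : Prop := {
  one_form_smooth : forall c u, A c ->
    smooth_on (coord c @` dom c) (fun x => eta c x u);
  one_form_linear : forall c x, A c -> (coord c @` dom c) x ->
    real_linear (eta c x);
  one_form_change : forall c c' x u, A c -> A c' ->
    (coord c @` (dom c `&` dom c')) x ->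
    eta c x u = eta c' (change c c' x) ('d (change c c') x u) }.

Record is_tensor2 (g : tensor2) : Prop := {
  tensor2_smooth : forall c u v, A c ->
    smooth_on (coord c @` dom c) (fun x => g c x u v);
  tensor2_linearl : forall c x v, A c -> (coord c @` dom c) x ->
    real_linear (fun u => g c x u v);
  tensor2_linearr : forall c x u, A c -> (coord c @` dom c) x ->
    real_linear (g c x u);
  tensor2_change : forall c c' x u v, A c -> A c' ->
    (coord c @` (dom c `&` dom c')) x ->
    g c x u v = g c' (change c c' x) ('d (change c c') x u)
                                     ('d (change c c') x v) }.

Definition Jmul u : C2 R := ('i%C : Cx R) *: u.

Record is_hermitian_metric (g : tensor2) : Prop := {
  hermitian_tensor : is_tensor2 g;
  hermitian_sym : forall c x u v, A c -> (coord c @` dom c) x ->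
    g c x u v = g c x v u;
  hermitian_pos : forall c x u, A c -> (coord c @` dom c) x ->
    u != 0 -> 0 < g c x u u;
  hermitian_J : forall c x u v, A c -> (coord c @` dom c) x ->
    g c x (Jmul u) (Jmul v) = g c x u v }.

(* The opposite convention [g c x u (Jmul v)] only changes the sign of
   [omega], which does not affect its Lee form. *)
Definition is_fundamental_form (omega : tensor2) : Prop :=
  exists2 g, is_hermitian_metric g &
    forall c x u v, A c -> (coord c @` dom c) x ->
      omega c x u v = g c x (Jmul u) v.

(* Exterior derivatives and wedge product, evaluated on constant vector
   fields of the chart. *)
Definition d1 (eta : tensor1) c x u v : R :=
  real_derive (fun y => eta c y v) x u - real_derive (fun y => eta c y u) x v.

Definition d2 (omega : tensor2) c x u v w : R :=
  real_derive (fun y => omega c y v w) x u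
  - real_derive (fun y => omega c y u w) x v
  + real_derive (fun y => omega c y u v) x w.

Definition wedge12 (eta : tensor1) (omega : tensor2) c x u v w : R :=
  eta c x u * omega c x v w - eta c x v * omega c x u w
  + eta c x w * omega c x u v.

Definition is_closed1 (eta : tensor1) : Prop :=
  forall c x u v, A c -> (coord c @` dom c) x -> d1 eta c x u v = 0.

Definition is_Lee_form (omega : tensor2) (eta : tensor1) : Prop :=
  [/\ is_one_form eta, is_closed1 eta &
      forall c x u v w, A c -> (coord c @` dom c) x ->
        d2 omega c x u v w = wedge12 eta omega c x u v w].

Definition is_lck (omega : tensor2) : Prop :=
  is_fundamental_form omega /\ exists eta, is_Lee_form omega eta.

(* [eta = df] on [U] *)
Definition is_primitive_on U (f : M -> R) (eta : tensor1) : Prop :=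
  smooth_fun_on U f /\
  forall c x u, A c -> (coord c @` (dom c `&` U)) x ->
    real_derive (f \o param c) x u = eta c x u.

(* Line bundles are given by transition functions: a section is a family [s i]
   of functions on [lb_dom i] such that [s i = lb_trans i j * s j] on overlaps.
   The values of [lb_trans i j] outside [lb_dom i `&` lb_dom j] are
   irrelevant.  The cocycle condition is not part of the data; for the two
   bundles used below, it holds by construction. *)
Record line_bundle := LineBundle {
  lb_index : Type;
  lb_dom : lb_index -> set M;
  lb_trans : lb_index -> lb_index -> M -> Cx R }.

Record flat_line_bundle := FlatLineBundle {
  fl_index : Type;
  fl_dom : fl_index -> set M;
  fl_trans : fl_index -> fl_index -> R }.

Definition line_bundle_of_flat (L : flat_line_bundle) : line_bundle :=
  {| lb_dom := @fl_dom L;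
     lb_trans := fun i j _ => (fl_trans i j)%:C |}.

Definition is_corresponding_flat (omega : tensor2) (L : flat_line_bundle) :
    Prop :=
  exists (eta : tensor1) (f : fl_index L -> M -> R)
         (lambda : fl_index L -> fl_index L -> R),
  [/\ is_Lee_form omega eta,
      (forall i : fl_index L, open (fl_dom i)) /\ (forall p, exists i : fl_index L, fl_dom i p),
      forall i : fl_index L, is_primitive_on (fl_dom i) (f i) eta,
      forall (i j : fl_index L) p, fl_dom i p -> fl_dom j p -> f i p - f j p = lambda i j &
      forall i j : fl_index L, fl_dom i `&` fl_dom j !=set0 ->
        fl_trans i j = expR (- lambda i j)].

(* A section of the canonical bundle is, in the chart [i], a holomorphic
   2-form [s i * dz_i1 /\ dz_i2], whence
   [s i = det (d z_j / d z_i) * s j]. *)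
Definition canonical_bundle : line_bundle :=
  {| lb_index := {c | A c};
     lb_dom := fun i => dom (sval i);
     lb_trans := fun i j p =>
       \det ('J (change (sval i) (sval j)) (coord (sval i) p)) |}.

(* [h i k] expresses the isomorphism in the trivializations of [L] over
   [lb_dom i] and of [L'] over [lb_dom k]. *)
Definition line_bundle_iso (L L' : line_bundle) : Prop :=
  exists h : lb_index L -> lb_index L' -> M -> Cx R,
  [/\ forall (i : lb_index L) (k : lb_index L'), holomorphic_on (lb_dom i `&` lb_dom k) (h i k),
      forall (i : lb_index L) (k : lb_index L') p, lb_dom i p -> lb_dom k p -> h i k p != 0 &
      forall (i j : lb_index L) (k l : lb_index L') p, lb_dom i p -> lb_dom j p -> lb_dom k p -> lb_dom l p ->
        lb_trans k l p * h j l p = h i k p * lb_trans i j p].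

End ComplexSurface.

(* * The group generated by a set of bijections *)

Inductive generated_group (T : Type) (G : set (T -> T)) : (T -> T) -> Prop :=
| generated_id : generated_group G id
| generated_gen g : G g -> generated_group G g
| generated_comp f g : generated_group G f -> generated_group G g ->
    generated_group G (f \o g)
| generated_inv f g : generated_group G f -> cancel f g -> cancel g f ->
    generated_group G g.

Lemma generated_group_bij (T : Type) (G : set (T -> T)) :
  (forall g, G g -> bijective g) ->
  forall f, generated_group G f -> bijective f.
Proof.
move=> Gbij f; elim=> {f} [|g /Gbij //|f g _ bf _ bg|f g _ _ fK gK].
- by exists id.
- exact: bij_comp.
- by exists f.
Qed.

Section OrbitRelation.
Variables (T : choiceType) (G : set (T -> T)).
Hypothesis Gbij : forall g, G g -> bijective g.

Definition orbit_rel : rel T :=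
  fun x y => `[< exists2 g, generated_group G g & g x = y >].

Lemma orbit_rel_equiv : equiv_class_of orbit_rel.
Proof.
split=> [x|x y|y x z].
- by apply/asboolP; exists id => //; exact: generated_id.
- have sym u v : orbit_rel u v -> orbit_rel v u.
    move=> /asboolP[g Gg <-]; apply/asboolP.
    have [h gK hK] := generated_group_bij Gbij Gg.
    by exists h; [exact: generated_inv gK hK|exact: gK].
  by apply/idP/idP => /sym.
- move=> /asboolP[g Gg <-] /asboolP[h Gh <-]; apply/asboolP.
  by exists (h \o g) => //; exact: generated_comp.
Qed.

Definition orbit_equiv : equiv_rel T :=
  EquivRelPack orbit_rel_equiv.

End OrbitRelation.

(* * The Inoue surfaces S^(+)_{N,p,q,r;t} *)

Section InoueVector.
Variables (R : realType) (N : 'M[int]_2) (a b : 'rV[R]_2).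

Definition inoue_e : 'rV[R]_2 :=
  \row_i (2^-1 * (N i 0)%:~R * ((N i 0)%:~R - 1) * a 0 0 * b 0 0
          + 2^-1 * (N i 1)%:~R * ((N i 1)%:~R - 1) * a 0 1 * b 0 1
          + (N i 0)%:~R * (N i 1)%:~R * b 0 0 * a 0 1).

Definition inoue_kappa (r : int) : R :=
  (b 0 0 * a 0 1 - b 0 1 * a 0 0) / r%:~R.

End InoueVector.

(* [ia], [ib] and [ic] are the rows (a_1,a_2), (b_1,b_2) and (c_1,c_2);
   the eigenvector conditions concern the corresponding columns, as is forced
   by the equation for [ic]. *)
Record inoue_data (R : realType) := InoueData {
  iN : 'M[int]_2;
  ialpha : R;
  ia : 'rV[R]_2;
  ib : 'rV[R]_2;
  ip : int;
  iq : int;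
  ir : int;
  ic : 'rV[R]_2;
  it : R[i];
  idet_N : \det iN = 1;
  ialpha_gt1 : 1 < ialpha;
  ia_neq0 : ia != 0;
  ia_eigen : map_mx intr iN *m ia^T = ialpha *: ia^T;
  ib_neq0 : ib != 0;
  ib_eigen : map_mx intr iN *m ib^T = ialpha^-1 *: ib^T;
  ir_neq0 : ir != 0;
  ic_eq : ic = ic *m (map_mx intr iN)^T + inoue_e iN ia ib
           + inoue_kappa ia ib ir *:
               (\row_j (if j == 0 then ip%:~R else iq%:~R)) }.

Section InoueSurface.
Variables (R : realType) (D : inoue_data R).
Local Notation C := (Cx R).
Local Notation kappa := (inoue_kappa (ia D) (ib D) (ir D)).

Definition pt (w z : C) : C2 R := \row_j (if j == 0 then w else z).

(* The product of the upper half plane (coordinate [x 0 0]) with the complex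
   plane (coordinate [x 0 1]). *)
Definition HC_set : set (C2 R) := [set x | 0 < complex.Im (x 0 0)].
Definition HC : topologicalType := HC_set.

Definition phi0 (x : C2 R) : C2 R :=
  pt ((ialpha D)%:C * x 0 0) (x 0 1 + it D).
Definition phi (i : 'I_2) (x : C2 R) : C2 R :=
  pt (x 0 0 + (ia D 0 i)%:C) (x 0 1 + (ib D 0 i)%:C * x 0 0 + (ic D 0 i)%:C).
Definition phi3 (x : C2 R) : C2 R :=
  pt (x 0 0) (x 0 1 + kappa%:C).

Lemma HC_Im_gt0 (x : HC) : 0 < complex.Im (val x 0 0).
Proof. by case: x => x /= /set_mem. Qed.

#[local] Lemma alpha_gt0 : 0 < ialpha D.
Proof. exact: lt_trans ltr01 (ialpha_gt1 D). Qed.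

Lemma HC_phi0 (x : HC) : HC_set (phi0 (val x)).
Proof.
have := HC_Im_gt0 x; rewrite /HC_set /phi0 /= mxE /=.
by case: (val x 0 0) => u v /= v0; rewrite mul0r addr0 mulr_gt0 ?alpha_gt0.
Qed.

Lemma HC_phi i (x : HC) : HC_set (phi i (val x)).
Proof.
have := HC_Im_gt0 x; rewrite /HC_set /phi /= mxE /=.
by case: (val x 0 0) => u v /= v0; rewrite addr0.
Qed.

Lemma HC_phi3 (x : HC) : HC_set (phi3 (val x)).
Proof. by have := HC_Im_gt0 x; rewrite /HC_set /phi3 /= mxE. Qed.

Definition HC_of (x : C2 R) (Hx : HC_set x) : HC := exist _ x (mem_set Hx).

Definition inoue_generator : set (HC -> HC) :=
  [set g | [\/ g = (fun x => HC_of (HC_phi0 x)),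
               exists i, g = (fun x => HC_of (HC_phi i x)) |
               g = (fun x => HC_of (HC_phi3 x))]].

Lemma inoue_generator_bij g : inoue_generator g -> bijective g.
Proof.
have bij (f : HC -> HC) (F F' : C2 R -> C2 R) :
    (forall x, val (f x) = F (val x)) -> cancel F F' -> cancel F' F ->
    (forall x : HC, HC_set (F' (val x))) -> bijective f.
  move=> fE FK F'K HF'; exists (fun x => HC_of (HF' x)) => x; apply: val_inj.
    by rewrite /= fE FK.
  by rewrite fE /= F'K.
have ext (x y : C2 R) : x 0 0 = y 0 0 -> x 0 1 = y 0 1 -> x = y.
  move=> e0 e1; apply/rowP; case=> -[|[|//]] k.
    by rewrite (_ : Ordinal k = 0); [|exact: val_inj].
  by rewrite (_ : Ordinal k = 1); [|exact: val_inj].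
have a0 : (ialpha D)%:C%C != 0 :> R[i].
  by rewrite eq_complex /= eqxx andbT gt_eqF ?alpha_gt0.
case=> [->|[i ->]|->].
- apply: (bij _ phi0
    (fun x => pt (((ialpha D)%:C%C : R[i])^-1 * x 0 0) (x 0 1 - it D))) => //.
  + by move=> x; apply: ext; rewrite !mxE /= ?mulKf ?addrK.
  + by move=> x; apply: ext; rewrite !mxE /= ?mulVKf ?subrK.
  + move=> x; have := HC_Im_gt0 x; rewrite /HC_set /= mxE /= -fmorphV.
    case: (val x 0 0) => u v /= v0.
    by rewrite mul0r addr0 mulr_gt0 ?invr_gt0 ?alpha_gt0.
- apply: (bij _ (phi i)
    (fun x => pt (x 0 0 - (ia D 0 i)%:C%C)
       (x 0 1 - (ic D 0 i)%:C%C
        - (ib D 0 i)%:C%C * (x 0 0 - (ia D 0 i)%:C%C)))) => //.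
  + by move=> x; apply: ext; rewrite !mxE /= ?addrK.
  + by move=> x; apply: ext; rewrite !mxE /= ?subrK.
  + move=> x; have := HC_Im_gt0 x; rewrite /HC_set /= mxE /=.
    by case: (val x 0 0) => u v /= v0; rewrite oppr0 addr0.
- apply: (bij _ phi3 (fun x => pt (x 0 0) (x 0 1 - kappa%:C%C))) => //.
  + by move=> x; apply: ext; rewrite !mxE /= ?addrK.
  + by move=> x; apply: ext; rewrite !mxE /= ?subrK.
  + by move=> x; have := HC_Im_gt0 x; rewrite /HC_set /= mxE.
Qed.

Definition inoue_equiv : equiv_rel HC := orbit_equiv inoue_generator_bij.

Definition inoue_surface : topologicalType :=
  quotient_topology {eq_quot inoue_equiv}.

Lemma inoue_base : HC_set (pt 'i%C 0).
Proof. by rewrite /HC_set /= mxE /= ltr01. Qed.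

Definition inoue_pi (x : C2 R) : inoue_surface :=
  \pi_inoue_surface (insubd (HC_of inoue_base) x).

(* The charts are the local sections of the quotient map; the inverse of a
   chart is the quotient map itself. *)
Definition inoue_atlas : set (chart R inoue_surface) :=
  [set c | [/\ open (dom c),
               forall p, dom c p -> {for p, continuous (coord c)},
               forall p, dom c p -> HC_set (coord c p) /\
                                    inoue_pi (coord c p) = p &
               param c = inoue_pi]].

End InoueSurface.

Arguments inoue_atlas {R} D _.

(* Main.v *)
From mathcomp Require Import all_boot all_order all_algebra.
From mathcomp Require Import generic_quotient complex.
From mathcomp Require Import all_classical all_reals all_analysis.
From mathcomp Require Import ring lra zify.
Require Import Defs.
Set Implicit Arguments.
Unset Strict Implicit.
Unset Printing Implicit Defensive.
Import Order.TTheory GRing.Theory Num.Theory numFieldNormedType.Exports.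
Local Open Scope classical_set_scope.
Local Open Scope quotient_scope.
Local Open Scope ring_scope.

(** Write y for the imaginary part of w on the universal cover H x C. Being
    convex, the universal cover carries a function F whose differential is the
    pull-back of the Lee form eta ([potential]). The transition functions of L'
    are exp(f_j - f_i), where the f_i are local primitives of eta, and those of
    K are the Jacobian determinants of the elements of the group that relate two
    charts; the determinant is alpha^n for an element that involves phi_0^n
    ([near_aff_diff]). So, in a chart k, the locally constant function
    exp(f_i - F) defines an isomorphism from L' to K as soon as
    F o gamma = F + n log alpha for every element gamma of the group.

    The pull-back of eta is invariant, so F o gamma - F is a constant, and this
    constant is additive in gamma. It vanishes on phi_3, a power of which is a
    commutator, and on phi_1 and phi_2, because conjugation by phi_0 acts on
    them as N, which does not have the eigenvalue 1 ([period3_eq0],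
    [periods_eq0]). These relations are where the equation defining c is used.

    It remains to find the constant h_0 of phi_0, and this is where the metric
    comes in. The form W = exp(-F) omega is closed, it is invariant under phi_1,
    phi_2 and phi_3, and phi_0 multiplies it by chi = exp(-h_0). Let q > 0 be
    its value on the real and imaginary directions of the z-axis. In the
    coordinates s = Re z and u = Im z / y, the integral of W over a part of the
    leaf w = i y is that of y q ds du. As W is closed, the derivative in y of
    this integral over a rectangle [0, K] x [0, T], where K is the period of
    phi_3, reduces to boundary terms. Those at s = 0 and s = K cancel by
    periodicity. Those at u = 0 and u = T involve only functions that are
    invariant under phi_1, phi_2 and phi_3, hence bounded when y stays in a
    compact interval, so they do not grow with T. Dividing by T, the mean of y q
    does not depend on y. But the size of y q on the level y = alpha^n is
    (alpha chi)^n up to constants. Therefore alpha chi = 1 ([flux_balance]),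
    that is, h_0 = log alpha. *)

(** * Integrals over a segment depending on a parameter *)

Section ParametricIntegral.
Variable R : realType.
Implicit Types (a b : R) (f g : R -> R).

Definition segint a b f : R := \int[lebesgue_measure]_(s in `[a, b]) f s.

Definition continuous_on_segment a b f :=
  forall s, a <= s <= b -> {for s, continuous f}.

Lemma continuous_on_segment_within a b f :
  continuous_on_segment a b f -> {within `[a, b], continuous f}.
Proof.
move=> cf; apply: continuous_in_subspaceT => s /set_mem /=.
by rewrite in_itv /= => /cf.
Qed.

Lemma segment_integrable a b f : continuous_on_segment a b f ->
  lebesgue_measure.-integrable `[a, b] (EFin \o f).
Proof.
move=> /continuous_on_segment_within cf.
by apply: continuous_compact_integrable => //; exact: segment_compact.
Qed.

Lemma eq_segint a b f g : (forall s, a <= s <= b -> f s = g s) ->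
  segint a b f = segint a b g.
Proof.
by move=> fg; apply: eq_Rintegral => s /set_mem /=; rewrite in_itv /= => /fg.
Qed.

Lemma segintB a b f g :
  continuous_on_segment a b f -> continuous_on_segment a b g ->
  segint a b (fun s => f s - g s) = segint a b f - segint a b g.
Proof. by move=> cf cg; apply: RintegralB => //; exact: segment_integrable. Qed.

Lemma segint_cst a b c : a <= b -> segint a b (fun=> c) = c * (b - a).
Proof.
move=> ab; rewrite /segint Rintegral_cst //= lebesgue_measure_itv /= lte_fin.
by case: ltgtP ab => // -> _; rewrite subrr.
Qed.

Lemma le_segint a b f g :
  continuous_on_segment a b f -> continuous_on_segment a b g ->
  (forall s, a <= s <= b -> f s <= g s) -> segint a b f <= segint a b g.
Proof.
move=> cf cg fg; apply: le_Rintegral => //; exact: segment_integrable.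
Qed.

Lemma segint_FTC a b f F : a < b -> continuous_on_segment a b f ->
  (forall s, a <= s <= b -> is_derive s 1 F (f s)) ->
  segint a b f = F b - F a.
Proof.
move=> ab cf dF; rewrite /segint /Rintegral (@continuous_FTC2 _ f F) //.
- exact: continuous_on_segment_within.
- have cF s : a <= s <= b -> {for s, continuous F}.
    move=> /dF dFs; apply: differentiable_continuous.
    by apply/derivable1_diffP; exact: ex_derive.
  split.
  + move=> s; rewrite in_itv /= => /andP[as_ sb].
    by apply: (@ex_derive _ _ _ _ _ _ _ (dF s _)); rewrite !ltW.
  + by apply: cvg_at_right_filter; apply: cF; rewrite lexx ltW.
  + by apply: cvg_at_left_filter; apply: cF; rewrite lexx ltW.
- move=> s; rewrite in_itv /= => /andP[as_ sb].
  have dFs : is_derive s 1 F (f s) by apply: dF; rewrite !ltW.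
  by rewrite derive1E derive_val.
Qed.

Definition jointly_continuous_at (P : topologicalType) (f : R -> P -> R) a b p :=
  forall s, a <= s <= b -> {for (s, p), continuous (fun q : R * P => f q.1 q.2)}.

Lemma jointly_continuous_segment (P : topologicalType) (f : R -> P -> R) a b p :
  jointly_continuous_at f a b p -> continuous_on_segment a b (f^~ p).
Proof.
move=> cf s /cf csp.
apply: (@continuous_comp _ _ _ (fun s => (s, p)) (fun q : R * P => f q.1 q.2)) => //.
exact: (cvg_pair cvg_id (cvg_cst p)).
Qed.

(** Tube lemma: as the segment is compact, the neighbourhoods of p obtained at
    its various points have a common one. *)
Lemma jointly_continuous_uniform (P : topologicalType) (f : R -> P -> R) a b p e :
  0 < e -> jointly_continuous_at f a b p ->
  \forall q \near p, forall s, a <= s <= b -> `|f s q - f s p| < e.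
Proof.
move=> e0 cf.
have /compact_near_coveringP cpt := @segment_compact R a b.
have := cpt P (nbhs p) (fun q s => `|f s q - f s p| < e) _.
have H : forall s, `[a, b]%classic s ->
    \forall s' \near s & q \near p, `|f s' q - f s' p| < e.
  move=> s /=; rewrite in_itv /= => abs.
  have e20 : 0 < e / 2 by rewrite divr_gt0.
  have /cvgrPdist_lt /(_ _ e20) cs := cf _ abs.
  have /cvgrPdist_lt /(_ _ e20) cs' := jointly_continuous_segment cf abs.
  case: cs => -[U V] /= [nU nV] UV.
  exists (U `&` [set s' | `|f s p - f s' p| < e / 2], V).
    by split=> //=; apply: filterI.
  move=> [s' q] /= [[Us' h2] Vq].
  have h1 : `|f s p - f s' q| < e / 2 by exact: (UV (s', q)).
  rewrite (_ : f s' q - f s' p = (f s p - f s' p) - (f s p - f s' q)); last by ring.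
  by rewrite (le_lt_trans (ler_normB _ _)) // (splitr e) ltrD.
move=> /(_ _ H); apply: filterS => q Hq s abs.
by apply: Hq; rewrite /= in_itv.
Qed.

Lemma continuous_segint_param (P : topologicalType) (f : R -> P -> R) a b p :
  a <= b -> (\forall q \near p, jointly_continuous_at f a b q) ->
  {for p, continuous (fun q => segint a b (f^~ q))}.
Proof.
move=> ab cf; apply/cvgrPdist_le => e e0.
have cfp := nbhs_singleton cf.
have e'0 : 0 < e / (b - a + 1) by rewrite divr_gt0 // ltr_wpDl ?subr_ge0.
have unif := jointly_continuous_uniform e'0 cfp.
near=> q.
have cfq : jointly_continuous_at f a b q by near: q.
have fq : forall s, a <= s <= b -> `|f s q - f s p| < e / (b - a + 1) by near: q.
rewrite -segintB; try exact: jointly_continuous_segment.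
have cd : continuous_on_segment a b (fun s => f s p - f s q).
  by move=> s abs; apply: continuousB; exact: (jointly_continuous_segment _ abs).
have cc (c : R) : continuous_on_segment a b (fun=> c) by move=> s _; exact: cst_continuous.
have le_e : e / (b - a + 1) * (b - a) <= e.
  rewrite -mulrAC ler_pdivrMr ?ltr_wpDl ?subr_ge0 //.
  by rewrite ler_wpM2l ?ltW // ltrDl.
rewrite ler_norml; apply/andP; split.
  rewrite lerNl (le_trans _ le_e) // lerNl -mulNr -segint_cst //.
  apply: le_segint => // s /fq; rewrite distrC => /ltW; rewrite ler_norml.
  by case/andP.
rewrite (le_trans _ le_e) // -segint_cst //.
apply: le_segint => // s /fq; rewrite distrC => /ltW; rewrite ler_norml.
by case/andP.
Unshelve. all: by end_near. Qed.

(** Near p the derivative in the parameter stays within 1 of its value at p; this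
    bound is integrable, so one may differentiate under the integral sign. *)
Lemma is_derive_segint_param (f df : R -> R -> R) a b (p : R) : a <= b ->
  (\forall q \near p, jointly_continuous_at f a b q) ->
  (\forall q \near p, jointly_continuous_at df a b q) ->
  (\forall q \near p, forall s : R, a <= s <= b -> is_derive (q : R) 1 (f s) (df s q)) ->
  is_derive p 1 (fun q => segint a b (f^~ q)) (segint a b (df^~ p)).
Proof.
move=> ab cf cdf dfE.
have cfp := nbhs_singleton cf.
have cdfp := nbhs_singleton cdf.
have unif := jointly_continuous_uniform ltr01 cdfp.
have /nbhs_ballP[d /= d0 H] : \forall q \near p,
    [/\ jointly_continuous_at f a b q,
     forall s, a <= s <= b -> is_derive q 1 (f s) (df s q) &
     forall s, a <= s <= b -> `|df s q - df s p| < 1].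
  by near=> q; split; near: q.
have HI q : q \in `](p - d), (p + d)[ -> 
    [/\ jointly_continuous_at f a b q,
     forall s, a <= s <= b -> is_derive q 1 (f s) (df s q) &
     forall s, a <= s <= b -> `|df s q - df s p| < 1].
  rewrite in_itv /= => /andP[h1 h2]; apply: H.
  by rewrite /ball /= ltr_norml; apply/andP; split; lra.
have Ip : `](p - d), (p + d)[%classic p.
  by rewrite /= in_itv /=; apply/andP; split; lra.
have d1E q s : q \in `](p - d), (p + d)[ -> a <= s <= b ->
    partial1of2 (fun q s => f s q) q s = df s q.
  move=> /HI[_ + _] => /[apply] ?.
  by rewrite partial1of2E derive_val.
have intf q : `](p - d), (p + d)[%classic q ->
    lebesgue_measure.-integrable `[a, b] (EFin \o (fun s => f s q)).
  move=> Iq; have [cq _ _] := HI _ Iq.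
  by apply: segment_integrable; exact: jointly_continuous_segment.
have derf q s : `](p - d), (p + d)[%classic q -> `[a, b]%classic s ->
    derivable (f s) q 1.
  move=> /HI[_ + _]; rewrite /= in_itv /= => /[apply] ?.
  exact: ex_derive.
pose G s : R := `|df s p| + 1.
have G0 s : 0 <= G s by rewrite addr_ge0.
have intG : lebesgue_measure.-integrable `[a, b] (EFin \o G).
  apply: segment_integrable => s abs; apply: continuousD; last exact: cst_continuous.
  apply: (@continuous_comp _ _ _ (df^~ p) (fun x : R => `|x|)); last exact: norm_continuous.
  exact: (jointly_continuous_segment cdfp).
have Gub q s : `](p - d), (p + d)[%classic q -> `[a, b]%classic s ->
    `|partial1of2 (fun q s => f s q) q s| <= G s.
  move=> Iq; rewrite /= in_itv /= => abs; rewrite d1E //.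
  have [_ _ /(_ _ abs)/ltW h] := HI _ Iq.
  rewrite -(subrK (df s p) (df s q)) (le_trans (ler_normD _ _)) //.
  by rewrite /G addrC lerD2l.
have mab : measurable `[a, b]%classic by exact: measurable_itv.
have dF := @derivable_under_integral R _ _ lebesgue_measure (fun q s => f s q)
  _ mab p _ _ Ip intf derf G G0 intG Gub.
have vF := @differentiation_under_integral R _ _ lebesgue_measure (fun q s => f s q)
  _ mab p _ _ Ip intf derf G G0 intG Gub.
apply: DeriveDef; first exact: dF.
rewrite -derive1E vF; apply: eq_Rintegral => s /set_mem /=; rewrite in_itv /=.
by move=> abs; rewrite d1E.
Unshelve. all: by end_near. Qed.

End ParametricIntegral.

(** * The group of the Inoue surface *)

Section InoueLattice.
Variables (R : realType) (D : inoue_data R).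
Local Notation al := (ialpha D).
Local Notation a1 := (ia D 0 0).
Local Notation a2 := (ia D 0 1).
Local Notation b1 := (ib D 0 0).
Local Notation b2 := (ib D 0 1).
Local Notation c1 := (ic D 0 0).
Local Notation c2 := (ic D 0 1).
Local Notation n11 := (iN D 0 0).
Local Notation n12 := (iN D 0 1).
Local Notation n21 := (iN D 1 0).
Local Notation n22 := (iN D 1 1).
Local Notation kappa := (inoue_kappa (ia D) (ib D) (ir D)).

Lemma al_gt0 : 0 < al. Proof. exact: lt_trans ltr01 (ialpha_gt1 D). Qed.
Lemma al_neq0 : al != 0. Proof. by rewrite gt_eqF // al_gt0. Qed.

Lemma sum_ord2 (V : nmodType) (F : 'I_2 -> V) : \sum_(i < 2) F i = F 0 + F 1.
Proof. by rewrite !big_ord_recl big_ord0 addr0; congr (_ + F _); apply: val_inj. Qed.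

Lemma eigen_ia i : (iN D i 0)%:~R * a1 + (iN D i 1)%:~R * a2 = al * ia D 0 i.
Proof.
have /colP/(_ i) := ia_eigen D.
by rewrite !mxE sum_ord2 !mxE.
Qed.

Lemma eigen_ib i : (iN D i 0)%:~R * b1 + (iN D i 1)%:~R * b2 = al^-1 * ib D 0 i.
Proof.
have /colP/(_ i) := ib_eigen D.
by rewrite !mxE sum_ord2 !mxE.
Qed.

Lemma det_iN : n11 * n22 - n12 * n21 = 1.
Proof.
have := idet_N D; rewrite (expand_det_row _ 0) sum_ord2 /cofactor !det_mx11 !mxE /=.
rewrite (_ : lift 0 0 = 1); last exact: val_inj.
rewrite (_ : lift 1 0 = 0); last exact: val_inj.
by rewrite expr0 expr1 => <-; ring.
Qed.

Lemma ir_kappa : (ir D)%:~R * kappa = b1 * a2 - b2 * a1.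
Proof. by rewrite /inoue_kappa mulrC divfK // intr_eq0 ir_neq0. Qed.

Lemma ic_fixed i : ic D 0 i = (iN D i 0)%:~R * c1 + (iN D i 1)%:~R * c2
  + inoue_e (iN D) (ia D) (ib D) 0 i
  + kappa * (if i == 0 then (ip D)%:~R else (iq D)%:~R).
Proof.
have /rowP/(_ i) := ic_eq D.
rewrite [in X in _ = X -> _]mxE [in X in _ = X -> _]mxE mxE sum_ord2 !mxE => ->.
by rewrite [in X in _ = X]mulrC [in X in _ = _ + X + _ + _]mulrC.
Qed.

(** Eigenvectors for the distinct eigenvalues alpha and 1/alpha are independent. *)
Lemma ia_ib_det_neq0 : b1 * a2 - b2 * a1 != 0.
Proof.
apply/eqP => d0.
have Ea i := eigen_ia i; have Eb i := eigen_ib i.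
have al1 := ialpha_gt1 D; have a0 := al_neq0.
have sq : al - al^-1 != 0.
  apply/eqP => h; have : al * al = 1 by rewrite -[X in _ * X](subrK al^-1) h add0r mulfV.
  by move=> h2; nra.
have ab11 : a1 * b1 = 0.
  apply: (mulfI sq); rewrite mulr0.
  have := Ea 0; have := Eb 0 => e1 e2.
  transitivity (al * a1 * b1 - a1 * (al^-1 * b1)); first by ring.
  rewrite -e1 -e2; transitivity (n12%:~R * (b1 * a2 - b2 * a1)); first by ring.
  by rewrite d0 mulr0.
have ab22 : a2 * b2 = 0.
  apply: (mulfI sq); rewrite mulr0.
  have := Ea 1; have := Eb 1 => e1 e2.
  transitivity (al * a2 * b2 - a2 * (al^-1 * b2)); first by ring.
  rewrite -e1 -e2; transitivity (- n21%:~R * (b1 * a2 - b2 * a1)); first by ring.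
  by rewrite d0 mulr0.
have ab12 : (al - al^-1) * (a1 * b2) = 0.
  have := Ea 0; have := Eb 0 => e1 e2.
  transitivity (al * a1 * b2 - a2 * (al^-1 * b1) + al^-1 * (b1 * a2 - b2 * a1)); first by ring.
  rewrite -e1 -e2 d0; transitivity (- n11%:~R * (b1 * a2 - b2 * a1)); first by ring.
  by rewrite d0 mulr0.
have {}ab12 : a1 * b2 = 0 by apply: (mulfI sq); rewrite mulr0.
have ab21 : a2 * b1 = 0 by nra.
have : (ia D != 0) && (ib D != 0) by rewrite ia_neq0 ib_neq0.
have ord2 (i : 'I_2) : i = 0 \/ i = 1.
  by case: i => -[|[|//]] h; [left|right]; exact: val_inj.
rewrite -negb_or => /negP; apply.
have [a10|a1n] := eqVneq a1 0.
  have [a20|a2n] := eqVneq a2 0.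
    by apply/orP; left; apply/eqP/rowP => i; rewrite mxE; case: (ord2 i) => ->.
  apply/orP; right; apply/eqP/rowP => i; rewrite mxE; case: (ord2 i) => ->.
    by apply: (mulfI a2n); rewrite mulr0.
  by apply: (mulfI a2n); rewrite mulr0.
apply/orP; right; apply/eqP/rowP => i; rewrite mxE; case: (ord2 i) => ->.
  by apply: (mulfI a1n); rewrite mulr0.
by apply: (mulfI a1n); rewrite mulr0.
Qed.

Lemma kappa_neq0 : kappa != 0.
Proof.
by apply: contraNneq ia_ib_det_neq0 => k0; rewrite -ir_kappa k0 mulr0.
Qed.

Definition heis_a (m1 m2 : int) : R := m1%:~R * a1 + m2%:~R * a2.
Definition heis_b (m1 m2 : int) : R := m1%:~R * b1 + m2%:~R * b2.
(** The translation of z in phi_1^m1 o phi_2^m2. The quadratic terms come from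
    the terms b_i w in phi_i, and for (m1, m2) a row of N they are the number e_i
    of the definition of the surface. *)
Definition heis_c (m1 m2 : int) : R :=
  2^-1 * m1%:~R * (m1%:~R - 1) * a1 * b1
  + 2^-1 * m2%:~R * (m2%:~R - 1) * a2 * b2
  + m1%:~R * m2%:~R * b1 * a2 + m1%:~R * c1 + m2%:~R * c2.

(** The triples (a, b, c) for which (w, z) |-> (w + a, z + b w + c) belongs to the
    group generated by phi_1, phi_2 and phi_3. *)
Definition heis_lattice (a b c : R) : Prop := exists m1 m2 k : int,
  [/\ a = heis_a m1 m2, b = heis_b m1 m2 & c = heis_c m1 m2 + kappa * k%:~R].

Lemma heis_lattice1 : heis_lattice 0 0 0.
Proof. by exists 0, 0, 0; rewrite /heis_a /heis_b /heis_c; split; ring. Qed.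

(** The failure of [heis_c] to be compatible with composition is an integral
    multiple of b_1 a_2 - b_2 a_1 = r kappa, which a power of phi_3 absorbs. *)
Lemma heis_latticeM a b c a' b' c' : heis_lattice a b c -> heis_lattice a' b' c' ->
  heis_lattice (a + a') (b + b') (c + c' + b * a').
Proof.
move=> [m1 [m2 [k [-> -> ->]]]] [m1' [m2' [k' [-> -> ->]]]].
exists (m1 + m1'), (m2 + m2'), (k + k' - m2 * m1' * ir D).
rewrite /heis_a /heis_b /heis_c; split; try ring.
transitivity (heis_c (m1 + m1') (m2 + m2') + kappa * (k + k')%:~R
   - m2%:~R * m1'%:~R * (b1 * a2 - b2 * a1)).
  by rewrite /heis_c; field.
by rewrite -ir_kappa /heis_c; ring.
Qed.

Lemma heis_latticeV a b c : heis_lattice a b c ->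
  heis_lattice (- a) (- b) (- c + a * b).
Proof.
move=> [m1 [m2 [k [-> -> ->]]]].
exists (- m1), (- m2), (- k - m1 * m2 * ir D).
rewrite /heis_a /heis_b /heis_c; split; try ring.
transitivity (heis_c (- m1) (- m2) - kappa * k%:~R
   - m1%:~R * m2%:~R * (b1 * a2 - b2 * a1)).
  by rewrite /heis_c; field.
by rewrite -ir_kappa /heis_c; ring.
Qed.

Lemma half_prod (m : int) : exists h : int, m%:~R * (m%:~R - 1) = 2 * h%:~R :> R.
Proof.
have [q [->|->]] : exists q : int, m = 2 * q \/ m = 2 * q + 1.
- exists (m %/ 2)%Z; have := divz_eq m 2.
  have := @modz_ge0 m 2 isT; have := @ltz_pmod m 2 isT.
  by move: (m %% 2)%Z (m %/ 2)%Z => r q; lia.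
- by exists (q * (2 * q - 1)); ring.
- by exists ((2 * q + 1) * q); ring.
Qed.

(** This is the purpose of the equation for (c_1, c_2). Expanding the quadratic
    part of [heis_c] along the rows of N gives e_1 and e_2, products
    (N_i . a) (N_j . b) = a_i b_j, and multiples of r kappa. *)
Lemma heis_c_iN (m1 m2 : int) : exists j : int,
  heis_c (m1 * n11 + m2 * n21) (m1 * n12 + m2 * n22)
    = heis_c m1 m2 + kappa * j%:~R.
Proof.
have [h1 e1] := half_prod m1; have [h2 e2] := half_prod m2.
pose X := h1 * n11 * n12 + h2 * n21 * n22 + m1 * m2 * n12 * n21.
exists (X * ir D - m1 * ip D - m2 * iq D).
have aN i := eigen_ia i; have bN i := eigen_ib i.
have ab i j : ((iN D i 0)%:~R * a1 + (iN D i 1)%:~R * a2)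
    * ((iN D j 0)%:~R * b1 + (iN D j 1)%:~R * b2) = ia D 0 i * ib D 0 j.
  by rewrite eigen_ia eigen_ib mulrACA mulfV ?al_neq0 // mul1r.
have ec0 := ic_fixed 0; have ec1 := ic_fixed 1.
rewrite /= !mxE in ec0 ec1.
pose B (i : 'I_2) : R := (iN D i 0)%:~R ^+ 2 * a1 * b1 + (iN D i 1)%:~R ^+ 2 * a2 * b2
  + 2 * (iN D i 0)%:~R * (iN D i 1)%:~R * b1 * a2.
apply/eqP; rewrite -subr_eq0; apply/eqP.
rewrite /heis_c.
have d0 (x y : R) : x = y -> x - y = 0 by move->; rewrite subrr.
(* a combination of the equations for c, for the eigenvectors, for kappa and
   of m (m - 1) = 2 h, each written with right-hand side 0 *)
transitivity (
  - m1%:~R * (c1 - (n11%:~R * c1 + n12%:~R * c2 +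
         (2^-1 * n11%:~R * (n11%:~R - 1) * a1 * b1 + 2^-1 * n12%:~R * (n12%:~R - 1) * a2 * b2 +
          n11%:~R * n12%:~R * b1 * a2) + kappa * (ip D)%:~R))
  - m2%:~R * (c2 - (n21%:~R * c1 + n22%:~R * c2 +
         (2^-1 * n21%:~R * (n21%:~R - 1) * a1 * b1 + 2^-1 * n22%:~R * (n22%:~R - 1) * a2 * b2 +
          n21%:~R * n22%:~R * b1 * a2) + kappa * (iq D)%:~R))
  + 2^-1 * (B 0 - a1 * b1) * (m1%:~R * (m1%:~R - 1) - 2 * h1%:~R)
  + 2^-1 * (B 1 - a2 * b2) * (m2%:~R * (m2%:~R - 1) - 2 * h2%:~R)
  + h1%:~R * ((n11%:~R * a1 + n12%:~R * a2) * (n11%:~R * b1 + n12%:~R * b2) - a1 * b1)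
  + h2%:~R * ((n21%:~R * a1 + n22%:~R * a2) * (n21%:~R * b1 + n22%:~R * b2) - a2 * b2)
  + m1%:~R * m2%:~R * ((n21%:~R * a1 + n22%:~R * a2) * (n11%:~R * b1 + n12%:~R * b2) - a2 * b1)
  - X%:~R * ((ir D)%:~R * kappa - (b1 * a2 - b2 * a1))).
  by rewrite /X /B; move: (inoue_kappa _ _ _) => K; field.
rewrite (d0 _ _ ec0) (d0 _ _ ec1) (d0 _ _ e1) (d0 _ _ e2) (d0 _ _ (ab 0 0)).
rewrite (d0 _ _ (ab 1 1)) (d0 _ _ (ab 1 0)) (d0 _ _ ir_kappa).
by rewrite !mulr0 !addr0 ?subr0 ?addr0.
Qed.

(** Conjugation by phi_0 acts on the lattice as N. *)
Lemma heis_lattice_al a b c : heis_lattice a b c ->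
  heis_lattice (al * a) (al^-1 * b) c.
Proof.
move=> [m1 [m2 [k [-> -> ->]]]]; have [j hj] := heis_c_iN m1 m2.
exists (m1 * n11 + m2 * n21), (m1 * n12 + m2 * n22), (k - j); split.
- rewrite /heis_a mulrDr !(mulrCA al) -!eigen_ia; ring.
- rewrite /heis_b mulrDr !(mulrCA al^-1) -!eigen_ib; ring.
- by rewrite hj; ring.
Qed.

Lemma heis_lattice_alV a b c : heis_lattice a b c ->
  heis_lattice (al^-1 * a) (al * b) c.
Proof.
move=> [m1 [m2 [k [-> -> ->]]]].
pose l1 := m1 * n22 - m2 * n21; pose l2 := - m1 * n12 + m2 * n11.
have [j hj] := heis_c_iN l1 l2; exists l1, l2, (k + j).
have E1 : m1 = l1 * n11 + l2 * n21.
  by rewrite -[LHS]mulr1 -det_iN /l1 /l2; ring.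
have E2 : m2 = l1 * n12 + l2 * n22.
  by rewrite -[LHS]mulr1 -det_iN /l1 /l2; ring.
split.
- rewrite {1}E1 {1}E2; apply: (mulfI al_neq0).
  rewrite mulrA mulfV ?al_neq0 // mul1r /heis_a mulrDr !(mulrCA al) -!eigen_ia; ring.
- rewrite {1}E1 {1}E2; apply: (mulfI (invr_neq0 al_neq0)).
  rewrite mulrA mulVf ?al_neq0 // mul1r /heis_b mulrDr !(mulrCA al^-1) -!eigen_ib; ring.
- by rewrite {1}E1 {1}E2 hj; ring.
Qed.

Lemma heis_lattice_alz (n : int) a b c : heis_lattice a b c ->
  heis_lattice (al ^ n * a) (al ^ (- n) * b) c.
Proof.
move=> H; elim: n => [|n IH|n IH].
- by rewrite oppr0 !expr0z !mul1r.
- have := heis_lattice_al IH; rewrite !mulrA.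
  by rewrite intS opprD !(expfzDr _ _ al_neq0) expr1z exprN1.
- have := heis_lattice_alV IH; rewrite !mulrA.
  by rewrite intS !opprD !opprK !(expfzDr _ _ al_neq0) expr1z exprN1.
Qed.

(** * Real-affine maps of C^2 *)

(** The elements of the group are such maps, with l a power of alpha. *)
Definition aff (l a b : R) (t : Cx R) (x : C2 R) : C2 R :=
  pt (l%:C%C * x 0 0 + a%:C%C) (x 0 1 + b%:C%C * x 0 0 + t).
Definition daff (l b : R) (u : C2 R) : C2 R :=
  pt (l%:C%C * u 0 0) (u 0 1 + b%:C%C * u 0 0).

Lemma pt0 (w z : Cx R) : (pt w z) 0 0 = w. Proof. by rewrite mxE. Qed.
Lemma pt1 (w z : Cx R) : (pt w z) 0 1 = z. Proof. by rewrite mxE. Qed.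

Lemma C2_ext (x y : C2 R) : x 0 0 = y 0 0 -> x 0 1 = y 0 1 -> x = y.
Proof.
move=> e0 e1; apply/rowP; case=> -[|[|//]] k.
  by rewrite (_ : Ordinal k = 0); [|exact: val_inj].
by rewrite (_ : Ordinal k = 1); [|exact: val_inj].
Qed.

Lemma aff_comp l a b t l' a' b' t' x :
  aff l a b t (aff l' a' b' t' x) =
  aff (l * l') (a + l * a') (b' + b * l') (t + t' + (b * a')%:C%C) x.
Proof.
apply: C2_ext; rewrite /aff ?pt0 ?pt1 !(rmorphM, rmorphD) /=; ring.
Qed.

Lemma aff_inj l a b t : l != 0 -> injective (aff l a b t).
Proof.
move=> l0 x y e.
have e0 : x 0 0 = y 0 0.
  have := congr1 (fun v : C2 R => v 0 0) e; rewrite /aff !pt0 => /addIr.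
  by apply: mulfI; rewrite eq_complex /= eqxx andbT.
apply: C2_ext => //.
by have := congr1 (fun v : C2 R => v 0 1) e; rewrite /aff !pt1 e0 => /addIr/addIr.
Qed.

(** The power phi_0^n followed by the Heisenberg map with parameters (a, b, c). *)
Definition inoue_affine (n : int) (a b c : R) : C2 R -> C2 R :=
  aff (al ^ n) a (b * al ^ n) (c%:C%C + (it D : Cx R) *~ n).

Lemma inoue_affineM n a b c n' a' b' c' x :
  inoue_affine n a b c (inoue_affine n' a' b' c' x) =
  inoue_affine (n + n') (a + al ^ n * a') (b + al ^ (- n) * b')
    (c + c' + b * (al ^ n * a')) x.
Proof.
rewrite /inoue_affine aff_comp !(expfzDr _ _ al_neq0) mulrzDr; congr (aff _ _ _ _ x).
  have e : al ^ (- n) * al ^ n = 1 by rewrite -(expfzDr _ _ al_neq0) addNr expr0z.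
  rewrite mulrDl addrC; congr (_ + _); first by ring.
  transitivity (b' * al ^ n' * (al ^ (- n) * al ^ n)); last by ring.
  by rewrite e mulr1.
by rewrite !(rmorphM, rmorphD) /=; ring.
Qed.

(** Since phi_0 normalizes the lattice, each element of the group is a lattice
    element composed with a power of phi_0. *)
Lemma generated_inoue g : generated_group (@inoue_generator R D) g ->
  exists (n : int) (a b c : R), heis_lattice a b c /\
    forall x, val (g x) = inoue_affine n a b c (val x).
Proof.
elim=> {g} [|g|f g _ [n [a [b [c [H E]]]]] _ [n' [a' [b' [c' [H' E']]]]]|].
- exists 0, 0, 0, 0; split; first exact: heis_lattice1.
  move=> x; apply: C2_ext; rewrite /inoue_affine /aff ?pt0 ?pt1 expr0z; ring.
- case=> [->|[i ->]|->].
  + exists 1, 0, 0, 0; split; first exact: heis_lattice1.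
    move=> x /=; apply: C2_ext; rewrite /inoue_affine /aff /phi0 ?pt0 ?pt1 expr1z; ring.
  + exists 0, (ia D 0 i), (ib D 0 i), (ic D 0 i); split.
      exists (i == 0)%:Z, (i == 1)%:Z, 0.
      rewrite /heis_a /heis_b /heis_c.
      case: i => -[|[|//]] Hi.
        by rewrite (_ : Ordinal Hi = 0); [|exact: val_inj]; split=> /=; ring.
      by rewrite (_ : Ordinal Hi = 1); [|exact: val_inj]; split=> /=; ring.
    move=> x /=; apply: C2_ext; rewrite /inoue_affine /aff /phi ?pt0 ?pt1 expr0z; ring.
  + exists 0, 0, 0, kappa; split.
      by exists 0, 0, 1; rewrite /heis_a /heis_b /heis_c; split; ring.
    move=> x /=; apply: C2_ext; rewrite /inoue_affine /aff /phi3 ?pt0 ?pt1 expr0z; ring.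
- exists (n + n'), (a + al ^ n * a'), (b + al ^ (- n) * b'), (c + c' + b * (al ^ n * a')).
  split; first exact: heis_latticeM H (heis_lattice_alz n H').
  by move=> x /=; rewrite E E' inoue_affineM.
- move=> f g _ [n [a [b [c [H E]]]]] fK gK.
  exists (- n), (- (al ^ (- n) * a)), (- (al ^ n * b)), (- c + a * b); split.
    have := heis_lattice_alz (- n) (heis_latticeV H).
    by rewrite opprK !mulrN.
  move=> x.
  have l0 : al ^ n != 0 by rewrite expfz_neq0 // al_neq0.
  suff : inoue_affine n a b c (val (g x)) = inoue_affine n a b c
      (inoue_affine (- n) (- (al ^ (- n) * a)) (- (al ^ n * b)) (- c + a * b) (val x)).
    exact: aff_inj.
  rewrite -E gK.
  rewrite inoue_affineM.
  have e : al ^ n * al ^ (- n) = 1 by rewrite -(expfzDr _ _ al_neq0) subrr expr0z.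
  have e' : al ^ (- n) * al ^ n = 1 by rewrite mulrC.
  have -> : c + (- c + a * b) + b * (al ^ n * - (al ^ (- n) * a)) = 0.
    by transitivity (a * b * (1 - al ^ n * al ^ (- n))); [ring|rewrite e; ring].
  rewrite subrr !mulrN !mulrA e e' !mul1r !subrr.
  apply: C2_ext; rewrite /inoue_affine /aff ?pt0 ?pt1 expr0z; ring.
Qed.

End InoueLattice.

(** * Real coordinates on C^2 *)

Section RealCoordinates.
Variable R : realType.
Implicit Types x y u : C2 R.

Definition re0 x : R := complex.Re (x 0 0).
Definition im0 x : R := complex.Im (x 0 0).
Definition re1 x : R := complex.Re (x 0 1).
Definition im1 x : R := complex.Im (x 0 1).

Definition near_box (d : R) x y := [/\ `|re0 x - re0 y| < d, `|im0 x - im0 y| < d,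
  `|re1 x - re1 y| < d & `|im1 x - im1 y| < d].

Lemma complex_ballP (z z' e : Cx R) : 0 < e ->
  (`|complex.Re z - complex.Re z'| < complex.Re e / 2) ->
  (`|complex.Im z - complex.Im z'| < complex.Re e / 2) -> `|z - z'| < e.
Proof.
case: z => a b; case: z' => a' b'; case: e => e1 e2 /=.
rewrite ltcE /= => /andP[/eqP-> e0] h1 h2.
rewrite ltcE /= eqxx /=.
rewrite -[ltRHS](@ger0_norm _ e1) ?ltW // -sqrtr_sqr ltr_sqrt ?exprn_gt0 //.
have sq (p : R) : `|p| < e1 / 2 -> p ^+ 2 < e1 ^+ 2 / 4.
  by rewrite ltr_norml => /andP[? ?]; nra.
have : 0 < e1 ^+ 2 by rewrite exprn_gt0.
by move: (sq _ h1) (sq _ h2) => ? ? ?; lra.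

Qed.

Lemma complex_ball_Re (z z' : Cx R) (e : R) : `|z - z'| < e%:C%C ->
  `|complex.Re z - complex.Re z'| < e /\ `|complex.Im z - complex.Im z'| < e.
Proof.
case: z => a b; case: z' => a' b' /=; rewrite ltcE /= eqxx /= => h.
have e0 : 0 < e by apply: le_lt_trans h; rewrite sqrtr_ge0.
have : (a - a') ^+ 2 + (b - b') ^+ 2 < e ^+ 2.
  by rewrite -ltr_sqrt ?exprn_gt0 // sqrtr_sqr (ger0_norm (ltW e0)).
move: (a - a') (b - b') => p q pq; split; rewrite ltr_norml; apply/andP; split; nra.
Qed.

(** The topology of C^2 is defined with complex radii; this reduces it to real
    distances between real coordinates. *)
Lemma nbhs_near_box x (U : set (C2 R)) :
  nbhs x U <-> exists2 d : R, 0 < d & forall y, near_box d x y -> U y.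
Proof.
split=> [/nbhs_ballP[e /= e0 H]|[d d0 H]].
  exists (complex.Re e / 2); first by move: e0; rewrite ltcE => /andP[_] ?; rewrite divr_gt0.
  move=> y [h1 h2 h3 h4]; apply: H; split=> [|i j]; first by [].
  move: h1 h2 h3 h4; rewrite /re0 /im0 /re1 /im1 => h1 h2 h3 h4.
  rewrite (ord1 i); case: j => -[|[|//]] k.
    by rewrite (_ : Ordinal k = 0); [apply: complex_ballP|exact: val_inj].
  by rewrite (_ : Ordinal k = 1); [apply: complex_ballP|exact: val_inj].
apply/nbhs_ballP; exists (d%:C%C : Cx R) => /=; first by rewrite ltcE /= eqxx.
move=> y [_ Hy]; apply: H.
have /complex_ball_Re[? ?] := Hy 0 0; have /complex_ball_Re[? ?] := Hy 0 1.
by split.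
Qed.

Lemma C2_cvg (T : Type) (F : set_system T) (FF : Filter F) (f : T -> C2 R) x :
  re0 (f t) @[t --> F] --> re0 x -> im0 (f t) @[t --> F] --> im0 x ->
  re1 (f t) @[t --> F] --> re1 x -> im1 (f t) @[t --> F] --> im1 x ->
  f t @[t --> F] --> x.
Proof.
move=> /cvgrPdist_lt h1 /cvgrPdist_lt h2 /cvgrPdist_lt h3 /cvgrPdist_lt h4.
move=> U /nbhs_near_box[d d0 H].
have : \forall t \near F, near_box d x (f t).
  by near=> t; split; near: t; [exact: h1|exact: h2|exact: h3|exact: h4].
by apply: filterS => t; exact: H.
Unshelve. all: by end_near. Qed.

Lemma C2_continuous_at (T : topologicalType) (f : T -> C2 R) t :
  {for t, continuous (re0 \o f)} -> {for t, continuous (im0 \o f)} ->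
  {for t, continuous (re1 \o f)} -> {for t, continuous (im1 \o f)} ->
  {for t, continuous f}.
Proof. by move=> h1 h2 h3 h4; exact: (@C2_cvg _ _ (nbhs_filter t)). Qed.

Lemma coord_continuous (f : C2 R -> R) :
  (forall x y d, near_box d x y -> `|f x - f y| < d) -> continuous f.
Proof.
move=> H x U /nbhs_ballP[e /= e0 HU].
by apply/nbhs_near_box; exists e => // y xy; apply: HU; exact: H.
Qed.
Lemma re0_continuous : continuous re0.
Proof. by apply: coord_continuous => x y d []. Qed.
Lemma im0_continuous : continuous im0.
Proof. by apply: coord_continuous => x y d []. Qed.
Lemma re1_continuous : continuous re1.
Proof. by apply: coord_continuous => x y d []. Qed.
Lemma im1_continuous : continuous im1.
Proof. by apply: coord_continuous => x y d []. Qed.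

Lemma HC_set_open : open (@HC_set R).
Proof.
rewrite (_ : @HC_set R = im0 @^-1` [set r | 0 < r]) //.
by apply: open_comp; [move=> x _; exact: im0_continuous|exact: open_gt].
Qed.

Lemma C2_eqP x y : re0 x = re0 y -> im0 x = im0 y -> re1 x = re1 y -> im1 x = im1 y -> x = y.
Proof.
move=> h1 h2 h3 h4; apply: C2_ext; apply/eqP; rewrite eq_complex; apply/andP; split; exact/eqP.
Qed.

Section Aff.
Variables (l a b : R) (t : Cx R).
Lemma re0_aff x : re0 (aff l a b t x) = l * re0 x + a.
Proof.
by rewrite /re0 /aff pt0; case: (x 0 0) => ? ? /=; rewrite !mul0r subr0.
Qed.
Lemma im0_aff x : im0 (aff l a b t x) = l * im0 x.
Proof.
by rewrite /im0 /aff pt0; case: (x 0 0) => ? ? /=; rewrite !mul0r !addr0.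
Qed.
Lemma re1_aff x : re1 (aff l a b t x) = re1 x + b * re0 x + complex.Re t.
Proof.
by rewrite /re1 /re0 /aff pt1; case: t (x 0 0) (x 0 1) => ? ? [? ?] [? ?] /=; rewrite !mul0r subr0.
Qed.
Lemma im1_aff x : im1 (aff l a b t x) = im1 x + b * im0 x + complex.Im t.
Proof.
by rewrite /im1 /im0 /aff pt1; case: t (x 0 0) (x 0 1) => ? ? [? ?] [? ?] /=; rewrite !mul0r addr0.
Qed.
Lemma aff_continuous : continuous (aff l a b t).
Proof.
move=> x; apply: C2_continuous_at.
- rewrite (_ : _ \o _ = (fun y => l * re0 y + a)); last by apply/funext => y; rewrite /= re0_aff.
  by apply: continuousD; [apply: continuousM; [exact: cst_continuous|]; exact: re0_continuous|exact: cst_continuous].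
- rewrite (_ : _ \o _ = (fun y => l * im0 y)); last by apply/funext => y; rewrite /= im0_aff.
  by apply: continuousM; [exact: cst_continuous|]; exact: im0_continuous.
- rewrite (_ : _ \o _ = (fun y => re1 y + b * re0 y + complex.Re t)); last by apply/funext => y; rewrite /= re1_aff.
  apply: continuousD; last exact: cst_continuous.
  by apply: continuousD; [exact: re1_continuous|apply: continuousM; [exact: cst_continuous|]; exact: re0_continuous].
- rewrite (_ : _ \o _ = (fun y => im1 y + b * im0 y + complex.Im t)); last by apply/funext => y; rewrite /= im1_aff.
  apply: continuousD; last exact: cst_continuous.
  by apply: continuousD; [exact: im1_continuous|apply: continuousM; [exact: cst_continuous|]; exact: im0_continuous].
Qed.
End Aff.

Lemma re0_line x u (s : R) : re0 (x + (s%:C%C : Cx R) *: u) = re0 x + s * re0 u.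
Proof. by rewrite /re0 !mxE; case: (x 0 0) (u 0 0) => ? ? [? ?] /=; rewrite mul0r subr0. Qed.
Lemma im0_line x u (s : R) : im0 (x + (s%:C%C : Cx R) *: u) = im0 x + s * im0 u.
Proof. by rewrite /im0 !mxE; case: (x 0 0) (u 0 0) => ? ? [? ?] /=; rewrite mul0r addr0. Qed.
Lemma re1_line x u (s : R) : re1 (x + (s%:C%C : Cx R) *: u) = re1 x + s * re1 u.
Proof. by rewrite /re1 !mxE; case: (x 0 1) (u 0 1) => ? ? [? ?] /=; rewrite mul0r subr0. Qed.
Lemma im1_line x u (s : R) : im1 (x + (s%:C%C : Cx R) *: u) = im1 x + s * im1 u.
Proof. by rewrite /im1 !mxE; case: (x 0 1) (u 0 1) => ? ? [? ?] /=; rewrite mul0r addr0. Qed.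

Lemma aff_line l a b t x u (s : R) :
  aff l a b t (x + (s%:C%C : Cx R) *: u) = aff l a b t x + (s%:C%C : Cx R) *: daff l b u.
Proof. by apply: C2_ext; rewrite /aff /daff !mxE /=; ring. Qed.

End RealCoordinates.

(** * Proper discontinuity of the action *)

Section Discontinuity.
Variables (R : realType) (D : inoue_data R).
Local Notation al := (ialpha D).
Local Notation a1 := (ia D 0 0).
Local Notation a2 := (ia D 0 1).
Local Notation b1 := (ib D 0 0).
Local Notation b2 := (ib D 0 1).
Local Notation kappa := (inoue_kappa (ia D) (ib D) (ir D)).

Lemma int_norm_lt1 (m : int) : `|m%:~R : R| < 1 -> m = 0.
Proof. by rewrite -intr_norm -[1]/(1%:~R) ltr_int; lia. Qed.

Lemma exprz_gt_al (n : int) : 0 < n -> al <= al ^ n.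
Proof.
case: n => [[//|n] _|//]; rewrite exprSz; apply: ler_peMr; first exact: ltW (al_gt0 D).
by rewrite -exprnP exprn_ege1 // ltW // ialpha_gt1.
Qed.

Lemma dist_lt_itv (d u v : R) : `|u - v| < d -> u - d < v < u + d.
Proof. by rewrite ltr_norml => /andP[? ?]; apply/andP; split; lra. Qed.

Lemma dist_lt_double (d u v w : R) : `|u - v| < d -> `|u - w| < d -> `|w - v| < 2 * d.
Proof.
by rewrite !ltr_norml => /andP[? ?] /andP[? ?]; apply/andP; split; lra.
Qed.

Lemma scaled_outside (y d l p v : R) : d * (l + 1) <= y * (l - 1) -> 0 < l ->
  y - d < v -> 0 <= y - d -> l <= p -> y + d < p * v.
Proof.
move=> hd l0 hv yd0 lp.
have h1 : l * v <= p * v by rewrite ler_wpM2r // (le_trans yd0) // ltW.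
have h2 : l * (y - d) < l * v by rewrite ltr_pM2l.
lra.
Qed.

(** This gives at once that the action is free and properly discontinuous. The
    level Im w detects the power of phi_0. Then Re w and Im z detect the point of
    the plane lattice generated by the (a_i, b_i), and Re z the power of phi_3. *)
Lemma inoue_discontinuous x : HC_set x -> exists2 d : R, 0 < d &
  forall n a b c y z, heis_lattice D a b c -> near_box d x y -> near_box d x z ->
    inoue_affine D n a b c y = z -> [/\ n = 0, a = 0, b = 0 & c = 0].
Proof.
rewrite /HC_set /= -/(im0 x) => x0.
have al1 := ialpha_gt1 D; have al0 := al_gt0 D.
have Delta0 := ia_ib_det_neq0 D; set Dt := _ - _ in Delta0.
have Dt0 : 0 < `|Dt| by rewrite normr_gt0.
have k0 : 0 < `|kappa| by rewrite normr_gt0 kappa_neq0.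
pose M := 2 * (`|b1| + `|b2|) + 4 * (`|a1| + `|a2|) / im0 x + 1.
have M0 : 0 < M.
  by rewrite ltr_wpDl // addr_ge0 // ?divr_ge0 ?mulr_ge0 ?addr_ge0 // ltW.
(* the four bounds exclude in turn n <> 0, an Im w below half its value at x,
   k <> 0 and (m1, m2) <> 0 *)
pose d := Num.min (Num.min (im0 x * (al - 1) / (al + 1)) (im0 x / 2))
                  (Num.min (`|kappa| / 2) (`|Dt| / M)).
have d0 : 0 < d by rewrite !lt_min !divr_gt0 // ?mulr_gt0 ?subr_gt0 ?addr_gt0.
have [d1 d2 d3 d4] : [/\ d <= im0 x * (al - 1) / (al + 1), d <= im0 x / 2,
    d <= `|kappa| / 2 & d <= `|Dt| / M].
  by split; rewrite /d !ge_min lexx ?orbT.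
move: d d0 d1 d2 d3 d4 => d d0 d1 d2 d3 d4.
exists d => // n a b c y z Hh [y1 y2 y3 y4] [z1 z2 z3 z4] E.
have Eim : im0 z = al ^ n * im0 y by rewrite -E im0_aff.
have d1' : d * (al + 1) <= im0 x * (al - 1) by rewrite -ler_pdivlMr // addr_gt0.
have /andP[y2a y2b] := dist_lt_itv y2; have /andP[z2a z2b] := dist_lt_itv z2.
have xd : im0 x / 2 <= im0 x - d by move: d2; clear; lra.
have xd0 : 0 <= im0 x - d by apply: le_trans xd; rewrite divr_ge0 // ltW.
have y0 : im0 x / 2 < im0 y by exact: le_lt_trans xd y2a.
have n0 : n = 0.
  case: (ltrgtP n 0) => // hn.
    have h : al <= al ^ (- n) by apply: exprz_gt_al; rewrite oppr_gt0.
    have := scaled_outside d1' al0 z2a xd0 h.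
    by rewrite Eim mulrA -(expfzDr _ _ (al_neq0 D)) addNr expr0z mul1r ltNge (ltW y2b).
  have := scaled_outside d1' al0 y2a xd0 (exprz_gt_al hn).
  by rewrite -Eim ltNge (ltW z2b).
move: E Eim; rewrite n0 /inoue_affine expr0z mulr0z addr0 mul1r mulr1 => E _.
have [m1 [m2 [k [ea eb ec]]]] := Hh.
have E0 : re0 z = re0 y + a by rewrite -E re0_aff mul1r.
have E1 : re1 z = re1 y + b * re0 y + c by rewrite -E re1_aff.
have E2 : im1 z = im1 y + b * im0 y by rewrite -E im1_aff /= addr0.
have ba : `|a| < 2 * d.
  by rewrite (_ : a = re0 z - re0 y); [exact: dist_lt_double y1 z1|rewrite E0; ring].
have bb : `|b| < 4 * d / im0 x.
  have h1 : `|b| * im0 y < 2 * d.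
    have y00 : 0 <= im0 y by rewrite (le_trans _ (ltW y0)) // divr_ge0 // ltW.
    rewrite -(ger0_norm y00) -normrM (_ : b * im0 y = im1 z - im1 y).
      exact: dist_lt_double y4 z4.
    by rewrite E2; ring.
  have h2 : `|b| * (im0 x / 2) <= `|b| * im0 y by rewrite ler_wpM2l // ltW.
  by rewrite ltr_pdivlMr //; move: h1 h2; clear; lra.
have dM : d * M <= `|Dt| by rewrite -ler_pdivlMr.
have key (u v : R) : `|u| <= `|b1| + `|b2| -> `|v| <= `|a1| + `|a2| ->
    `|a * u - b * v| < `|Dt|.
  move=> hu hv; apply: lt_le_trans dM.
  have h1 : `|a * u| <= 2 * d * (`|b1| + `|b2|) by rewrite normrM ler_pM // ltW.
  have h2 : `|b * v| <= 4 * d / im0 x * (`|a1| + `|a2|).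
    by rewrite normrM ler_pM // ltW.
  rewrite (le_lt_trans (ler_normB _ _)) // (le_lt_trans (lerD h1 h2)) //.
  rewrite (_ : d * M = 2 * d * (`|b1| + `|b2|) + 4 * d / im0 x * (`|a1| + `|a2|) + d).
    by rewrite ltrDl.
  by rewrite /M; ring.
(* Cramer's rule for m1 (a1, b1) + m2 (a2, b2) = (a, b) *)
have m10 : m1 = 0.
  apply: int_norm_lt1; rewrite -(ltr_pM2r Dt0) mul1r -normrM.
  rewrite (_ : _ * Dt = - (a * b2 - b * a2)).
    by rewrite normrN; apply: key; rewrite lerDr.
  by rewrite ea eb /heis_a /heis_b /Dt; ring.
have m20 : m2 = 0.
  apply: int_norm_lt1; rewrite -(ltr_pM2r Dt0) mul1r -normrM.
  rewrite (_ : _ * Dt = a * b1 - b * a1).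
    by apply: key; rewrite lerDl.
  by rewrite ea eb /heis_a /heis_b /Dt; ring.
have a0 : a = 0 by rewrite ea m10 m20 /heis_a; ring.
have b0 : b = 0 by rewrite eb m10 m20 /heis_b; ring.
split => //.
have ck : c = kappa * k%:~R by rewrite ec m10 m20 /heis_c; ring.
suff k00 : k = 0 by rewrite ck k00 mulr0.
apply: int_norm_lt1; rewrite -(ltr_pM2l k0) mulr1 -normrM -ck.
have := dist_lt_double y3 z3.
rewrite E1 b0 (_ : re1 y + _ + c - _ = c); last by ring.
by move/lt_le_trans; apply; rewrite mulrC -ler_pdivlMr.
Qed.

End Discontinuity.

(** * The quotient map and its charts *)

Section InoueTopology.
Variables (R : realType) (D : inoue_data R).
Local Notation Gam := (generated_group (@inoue_generator R D)).
Local Notation pi := (inoue_pi D).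

Definition toHC (x : C2 R) : HC R := insubd (HC_of (inoue_base R)) x.

Lemma toHC_val x : HC_set x -> val (toHC x) = x.
Proof. by move=> Hx; rewrite /toHC insubdK // unfold_in; apply/mem_set. Qed.

Lemma val_toHC (x : HC R) : toHC (val x) = x.
Proof. exact: valKd. Qed.

Lemma HC_setP (x : HC R) : HC_set (val x).
Proof. exact: HC_Im_gt0. Qed.

Lemma piE x y : HC_set x -> HC_set y ->
  (pi x = pi y <-> exists2 g, Gam g & val (g (toHC x)) = y).
Proof.
move=> Hx Hy; split.
  move=> /eqmodP/asboolP[g Gg gx]; exists g => //.
  by rewrite gx toHC_val.
move=> [g Gg gx]; apply/eqmodP/asboolP; exists g => //.
by apply: val_inj; rewrite gx toHC_val.
Qed.

Lemma inoue_pi_continuous x : HC_set x -> {for x, continuous pi}.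
Proof.
move=> Hx U; rewrite nbhsE => -[V [oV Vx] VU].
have [W oW WV] : open (\pi_(inoue_surface D) @^-1` V) by [].
have : nbhs x (W `&` @HC_set R).
  apply: filterI; last exact: open_nbhs_nbhs (conj (@HC_set_open R) Hx).
  apply: open_nbhs_nbhs; split => //.
  have : (\pi_(inoue_surface D) @^-1` V) (toHC x) by [].
  rewrite -WV => Wx; have : W (val (toHC x)) by exact: Wx.
  by rewrite toHC_val.
apply: filterS => y [Wy Hy]; apply: VU.
have : (\pi_(inoue_surface D) @^-1` V) (toHC y).
  by rewrite -WV; change (W (val (toHC y))); rewrite toHC_val.
by [].
Qed.

Lemma Gam_inoue_affine g : Gam g -> exists n a b c, heis_lattice D a b c /\
  forall x, HC_set x -> val (g (toHC x)) = inoue_affine D n a b c x.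
Proof.
move=> /generated_inoue[n [a [b [c [H E]]]]]; exists n, a, b, c; split => //.
by move=> x Hx; rewrite E toHC_val.
Qed.

(** The saturation of an open set is the union of its translates. *)
Lemma inoue_pi_open (U : set (C2 R)) : open U -> open (pi @` (U `&` @HC_set R)).
Proof.
move=> oU.
suff -> : pi @` (U `&` @HC_set R) = \pi_(inoue_surface D) @`
   [set h : HC R | U (val h)].
  rewrite /open /= /quotient_open.
  rewrite (_ : _ @^-1` _ = \bigcup_(g in [set g | Gam g]) [set h | U (val (g h))]).
    apply: bigcup_open => g /= /generated_inoue[n [a [b [c [_ E]]]]].
    exists (inoue_affine D n a b c @^-1` U).
      by apply: open_comp => // y _; exact: aff_continuous.
    by apply/seteqP; split => h /=; rewrite E.
  apply/seteqP; split => h /=.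
    move=> [k Uk] /eqmodP/asboolP[g Gg gk].
    have [g' gK g'K] := generated_group_bij (@inoue_generator_bij R D) Gg.
    by exists g'; [exact: generated_inv gK g'K|rewrite /= -gk gK].
  move=> [g Gg Ugh]; exists (g h) => //; apply/esym/eqmodP/asboolP.
  by exists g.
apply/seteqP; split => p /=.
  by move=> [x [Ux Hx] <-]; exists (toHC x) => //=; rewrite toHC_val.
move=> [h Uh <-]; exists (val h); first by split => //; exact: HC_setP.
by rewrite /inoue_pi -/(toHC _) val_toHC.
Qed.

Lemma Gam_discontinuous x : HC_set x -> exists2 d : R, 0 < d &
  forall g y z, Gam g -> HC_set y -> near_box d x y -> near_box d x z ->
    val (g (toHC y)) = z -> g =1 id.
Proof.
move=> /inoue_discontinuous -/(_ D)[d d0 H]; exists d => //.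
move=> g y z /generated_inoue[n [a [b [c [Hh E]]]]] Hy xy xz.
rewrite E toHC_val // => e.
have [n0 a0 b0 c0] := H _ _ _ _ _ _ Hh xy xz e.
move=> h; apply: val_inj; rewrite E n0 a0 b0 c0.
by apply: C2_ext; rewrite /inoue_affine /aff ?pt0 ?pt1 expr0z; ring.
Qed.

(** On a neighbourhood that does not meet its translates the quotient map is
    injective, and it is open; its inverse is a chart. *)
Lemma chart_exists x : HC_set x -> exists2 c, inoue_atlas D c &
  \forall y \near x, [/\ HC_set y, dom c (pi y) & coord c (pi y) = y].
Proof.
move=> Hx; have [d d0 H] := Gam_discontinuous Hx.
pose U := interior [set y | near_box d x y].
have oU : open U by exact: open_interior.
have UP y : U y -> near_box d x y by move=> /interior_subset.
have Ux : nbhs x U.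
  by apply: open_nbhs_nbhs; split => //; apply/nbhs_near_box; exists d.
have inj y z : U y -> U z -> HC_set y -> HC_set z -> pi y = pi z -> y = z.
  move=> Uy Uz Hy Hz /piE -/(_ Hy Hz)[g Gg gy].
  have g1 := H _ _ _ Gg Hy (UP _ Uy) (UP _ Uz) gy.
  by rewrite -gy g1 toHC_val.
pose co p := xget x [set y | [/\ U y, HC_set y & pi y = p]].
have coE y : U y -> HC_set y -> co (pi y) = y.
  move=> Uy Hy; rewrite /co; case: xgetP => [z _ [Uz Hz e]|/(_ y)[]//].
  exact: inj.
exists (Chart (pi @` (U `&` @HC_set R)) co pi).
  split => //=; first exact: inoue_pi_open.
    move=> p [y [Uy Hy] <-] V; rewrite coE // nbhsE => -[V' [oV' V'y] V'V].
    have : nbhs (pi y) (pi @` ((U `&` V') `&` @HC_set R)).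
      apply: open_nbhs_nbhs; split; first by apply: inoue_pi_open; exact: openI.
      by exists y.
    by apply: filterS => _ [z [[Uz V'z] Hz] <-]; rewrite /= coE //; exact: V'V.
  by move=> p [y [Uy Hy] <-]; rewrite coE.
have HxN : nbhs x (@HC_set R) by exact: open_nbhs_nbhs (conj (@HC_set_open R) Hx).
apply: filterS (filterI Ux HxN) => y [Uy Hy] /=.
by split => //; [exists y|exact: coE].
Qed.

(** Two local sections of the quotient map differ by elements of the group, and
    by proper discontinuity the element does not vary near a point. *)
Lemma coord_local c x : inoue_atlas D c -> HC_set x -> dom c (pi x) ->
  exists2 g, Gam g & \forall y \near x,
    [/\ HC_set y, dom c (pi y) & coord c (pi y) = val (g (toHC y))].
Proof.
move=> [od cc cE pE] Hx dx.
have [Hcx picx] := cE _ dx.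
have [g Gg gx] : exists2 g, Gam g & val (g (toHC x)) = coord c (pi x).
  exact/piE.
exists g => //.
have [g' gK g'K] := generated_group_bij (@inoue_generator_bij R D) Gg.
have Gg' : Gam g' by exact: generated_inv gK g'K.
have [d d0 H] := Gam_discontinuous Hx.
have [n [a [b [c0 [_ g'E]]]]] := Gam_inoue_affine Gg'.
have HxN : nbhs x (@HC_set R) by exact: open_nbhs_nbhs (conj (@HC_set_open R) Hx).
have dN : \forall y \near x, dom c (pi y).
  by apply: (inoue_pi_continuous Hx); exact: open_nbhs_nbhs (conj od dx).
have bN : \forall y \near x, near_box d x y by apply/nbhs_near_box; exists d.
have kN : \forall y \near x, near_box d x (inoue_affine D n a b c0 (coord c (pi y))).
  have : {for x, continuous (inoue_affine D n a b c0 \o (coord c \o pi))}.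
    apply: continuous_comp; last exact: aff_continuous.
    by apply: continuous_comp; [exact: inoue_pi_continuous|exact: cc].
  have e : inoue_affine D n a b c0 (coord c (pi x)) = x.
    by rewrite -g'E // -gx val_toHC gK toHC_val.
  move=> /(_ [set y | near_box d x y]); apply.
  by rewrite /= e; exact: bN.
near=> y.
have Hy : HC_set y by near: y.
have dy : dom c (pi y) by near: y.
have [Hcy picy] := cE _ dy.
have [h Gh hy] : exists2 h, Gam h & val (h (toHC y)) = coord c (pi y).
  exact/piE.
split => //.
have e : val ((g' \o h) (toHC y)) = inoue_affine D n a b c0 (coord c (pi y)).
  by rewrite /= -g'E // -hy val_toHC.
have bx : near_box d x y by near: y.
have kx : near_box d x (inoue_affine D n a b c0 (coord c (pi y))) by near: y.
have g'h := H _ _ _ (generated_comp Gg' Gh) Hy bx kx e.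
by rewrite -hy; congr val; rewrite -[RHS](congr1 g (g'h (toHC y))) /= g'K.
Unshelve. all: by end_near. Qed.

End InoueTopology.

(** * Differentials of affine maps *)

Lemma near_affine_diff (K : numFieldType) (V W : normedModType K) (f : V -> W)
    (L : {linear V -> W}) (x : V) :
  continuous L -> (\forall h \near (0 : V), f (h + x) = f x + L h) ->
  differentiable f x /\ 'd f x = L :> (V -> W).
Proof.
move=> cL fL.
have o : f \o shift x = cst (f x) + L +o_ 0 id.
  apply/eqaddoP => e e0; near=> h.
  rewrite -[X in `|X| <= _]/(f (h + x) - (f x + L h)).
  have -> : f (h + x) = f x + L h by near: h.
  by rewrite subrr normr0 mulr_ge0 // ltW.
have dE := diff_unique cL o.
split=> //; apply/diff_locallyP; split; rewrite dE //.
Unshelve. all: by end_near. Qed.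

Section AffDiff.
Variable R : realType.

Definition daff_mx (l b : R) : 'M[Cx R]_2 :=
  \matrix_(i, j) if j == 0 then (if i == 0 then l%:C%C else 0)
                 else (if i == 0 then b%:C%C else 1).

Lemma daffE l b (u : C2 R) : daff l b u = mulmxr (daff_mx l b) u.
Proof.
by apply: C2_ext; rewrite /= /daff !mxE ?sum_ord2 !mxE /=; ring.
Qed.

Lemma mulmxr_daff_continuous l b : continuous (mulmxr (daff_mx l b) : C2 R -> C2 R).
Proof.
rewrite (_ : (mulmxr _ : C2 R -> C2 R) = aff l 0 b 0); first exact: aff_continuous.
apply/funext => u; rewrite -daffE; apply: C2_ext; rewrite /aff /daff !mxE /=; ring.
Qed.

Lemma near0_shift (x : C2 R) (P : C2 R -> Prop) :
  (\forall y \near x, P y) -> \forall h \near (0 : C2 R), P (h + x).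
Proof.
move=> /nbhs_near_box[d d0 H]; apply/nbhs_near_box; exists d => // h Hh.
apply: H; case: Hh; rewrite /near_box.
rewrite (_ : h + x = x + ((1 : R)%:C%C : Cx R) *: h); last by rewrite addrC scale1r.
rewrite re0_line im0_line re1_line im1_line !mul1r !opprD !addrA !subrr.
have -> : re0 (0 : C2 R) = 0 by rewrite /re0 mxE.
have -> : im0 (0 : C2 R) = 0 by rewrite /im0 mxE.
have -> : re1 (0 : C2 R) = 0 by rewrite /re1 mxE.
by have -> : im1 (0 : C2 R) = 0 by rewrite /im1 mxE.
Qed.

(** The determinant does not see b: the transition functions of the canonical
    bundle only depend on the power of phi_0. *)
Lemma near_aff_diff (f : C2 R -> C2 R) l a b t x :
  (\forall y \near x, f y = aff l a b t y) ->
  'd f x = daff l b :> (C2 R -> C2 R) /\ \det ('J f x) = l%:C%C.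
Proof.
move=> fE.
have [|df dE] := near_affine_diff (f := f) (x := x) (@mulmxr_daff_continuous l b).
  have := near0_shift fE; apply: filterS => h ->.
  rewrite (nbhs_singleton fE); apply: C2_ext; rewrite /aff /= !mxE ?sum_ord2 !mxE /=; ring.
have dE' : 'd f x = daff l b :> (C2 R -> C2 R).
  by rewrite dE; apply/funext => u; rewrite daffE.
split=> //.
have -> : 'J f x = daff_mx l b.
  apply/row_matrixP => i; rewrite !rowE /jacobian mul_rV_lin1.
  by rewrite dE.
rewrite (expand_det_row _ 0) sum_ord2 /cofactor !det_mx11 !mxE /=.
by rewrite ?expr0 ?expr1; ring.
Qed.

Lemma near_cst_differentiable (f : C2 R -> Cx R) x :
  (\forall y \near x, f y = f x) -> differentiable f x.
Proof.
move=> fE.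
have [| |//] := @near_affine_diff _ _ _ f (\0 : {linear C2 R -> Cx R}) x.
  by move=> y; exact: cst_continuous.
have := near0_shift fE; apply: filterS => h ->.
by rewrite addr0.
Qed.

End AffDiff.

(** * Calculus along real lines *)

Section RealLines.
Variable R : realType.
Implicit Types (f g : C2 R -> R) (x y u : C2 R).

Lemma line_continuous x u (s0 : R) :
  {for s0, continuous (fun s : R => x + (s%:C%C : Cx R) *: u)}.
Proof.
have E (h : R -> R) (p q : R) : (forall s, h s = p + s * q) -> {for s0, continuous h}.
  move=> hE; rewrite (_ : h = fun s => p + s * q); last exact/funext.
  apply: continuousD; first exact: cst_continuous.
  by apply: continuousM; [exact: cvg_id|exact: cst_continuous].
apply: C2_continuous_at.
- by apply: (E _ (re0 x) (re0 u)) => s; rewrite /= re0_line.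
- by apply: (E _ (im0 x) (im0 u)) => s; rewrite /= im0_line.
- by apply: (E _ (re1 x) (re1 u)) => s; rewrite /= re1_line.
- by apply: (E _ (im1 x) (im1 u)) => s; rewrite /= im1_line.
Qed.

Lemma line0 x u : x + ((0 : R)%:C%C : Cx R) *: u = x.
Proof. by rewrite scale0r addr0. Qed.

Lemma near_line x u (P : C2 R -> Prop) : (\forall y \near x, P y) ->
  \forall s \near (0 : R), P (x + (s%:C%C : Cx R) *: u).
Proof. by move=> H; apply: (@line_continuous x u 0); rewrite line0. Qed.

Lemma real_line_near f g x u : (\forall y \near x, f y = g y) ->
  \forall s \near (0 : R), real_line f x u s = real_line g x u s.
Proof. exact: near_line. Qed.

Lemma lineD x u (s0 s : R) :
  x + (s0%:C%C : Cx R) *: u + (s%:C%C : Cx R) *: u = x + ((s + s0)%:C%C : Cx R) *: u.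
Proof.
rewrite addrAC -addrA -scalerDl; congr (_ + _ *: _).
by rewrite rmorphD.
Qed.

Lemma real_line_shift f x u (s0 : R) :
  real_line f (x + (s0%:C%C : Cx R) *: u) u = fun s => real_line f x u (s + s0).
Proof. by apply/funext => s; rewrite /real_line lineD. Qed.

Lemma is_derive_shift0 (h : R -> R) (s0 : R) (dh : R) :
  is_derive (0 : R) 1 (fun s => h (s + s0)) dh -> is_derive s0 1 h dh.
Proof.
move=> H.
have -> : h = (fun s => h (s + s0)) \o shift (- s0).
  by apply/funext => s /=; rewrite subrK.
rewrite -[dh]mulr1; apply: is_derive1_comp; first by rewrite /= subrr.
exact: is_derive_shift.
Qed.

Definition line_derivable f x := forall u, derivable (real_line f x u) 0 1.

Lemma line_is_derive f x u : line_derivable f x ->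
  is_derive (0 : R) 1 (real_line f x u) (real_derive f x u).
Proof. by move=> df; apply: DeriveDef; [exact: df|rewrite -derive1E]. Qed.

Lemma line_is_derive_at f x u (s : R) :
  line_derivable f (x + (s%:C%C : Cx R) *: u) ->
  is_derive s 1 (real_line f x u) (real_derive f (x + (s%:C%C : Cx R) *: u) u).
Proof.
by move=> /line_is_derive -/(_ u); rewrite real_line_shift => /is_derive_shift0.
Qed.

Lemma real_derive_val f x u df :
  is_derive (0 : R) 1 (real_line f x u) df -> real_derive f x u = df.
Proof. by move=> H; rewrite /real_derive derive1E derive_val. Qed.

Lemma near_eq_line_derivable f g x : (\forall y \near x, f y = g y) ->
  line_derivable f x -> line_derivable g x.
Proof.
by move=> fg df u; apply: near_eq_derivable (df u); exact: real_line_near.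
Qed.

Lemma near_eq_real_derive f g x u : (\forall y \near x, f y = g y) ->
  real_derive f x u = real_derive g x u.
Proof.
by move=> fg; rewrite /real_derive !derive1E; apply: near_eq_derive; exact: real_line_near.
Qed.

Definition C1_at f x := [/\ {for x, continuous f}, line_derivable f x &
  forall u, {for x, continuous (fun y => real_derive f y u)}].

Lemma near_eq_continuous (T : topologicalType) (f g : C2 R -> T) x :
  (\forall y \near x, f y = g y) -> {for x, continuous f} -> {for x, continuous g}.
Proof.
move=> fg cf U; rewrite -(nbhs_singleton fg) => /cf /= fU.
by apply: filterS (filterI fg fU) => y [/= <-].
Qed.

Lemma near_eq_C1 f g x : (\forall y \near x, f y = g y) -> C1_at f x -> C1_at g x.
Proof.
move=> fg [cf df cdf]; split.
- exact: near_eq_continuous cf.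
- exact: near_eq_line_derivable df.
- move=> u; apply: near_eq_continuous (cdf u).
  have := near_join fg; apply: filterS => y; exact: near_eq_real_derive.
Qed.

Lemma Ck_on_C1 W f x : Ck_on 1 W f -> nbhs x W -> C1_at f x.
Proof.
move=> [cf df] Wx; have {}Wx := nbhs_singleton Wx; split; first exact: cf.
- by move=> u; have [+ _] := df u; apply.
- by move=> u; have [_ [+ _]] := df u; apply.
Qed.

(** Mean value theorem on the segment from x to x + u. *)
Lemma line_cst f x u : (forall s : R, 0 <= s <= 1 ->
    line_derivable f (x + (s%:C%C : Cx R) *: u) /\
    real_derive f (x + (s%:C%C : Cx R) *: u) u = 0) ->
  f (x + u) = f x.
Proof.
move=> H.
have D (s : R) : 0 <= s <= 1 -> is_derive s 1 (real_line f x u) 0.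
  by move=> /H[df <-]; exact: line_is_derive_at.
have [| |c _] := @MVT_segment R (real_line f x u) (fun=> 0) 0 1 ler01.
- by move=> s; rewrite in_itv /= => /andP[? ?]; apply: D; rewrite !ltW.
- apply: continuous_in_subspaceT => s /set_mem /=; rewrite in_itv /= => /D ds.
  by apply: differentiable_continuous; apply/derivable1_diffP; exact: ex_derive.
rewrite mul0r => /eqP; rewrite subr_eq0 => /eqP.
by rewrite /real_line line0 scale1r.
Qed.

End RealLines.

(** * Tensors on the universal cover *)

Section Pullback.
Variables (R : realType) (D : inoue_data R).
Local Notation Gam := (generated_group (@inoue_generator R D)).
Local Notation pi := (inoue_pi D).
Local Notation A := (inoue_atlas D).

Definition deck (l a b : R) (t : Cx R) := 0 < l /\
  exists2 g, Gam g & forall x, HC_set x -> val (g (toHC x)) = aff l a b t x.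

Lemma aff_HC l a b t (x : C2 R) : 0 < l -> HC_set x -> HC_set (aff l a b t x).
Proof.
move=> l0; rewrite /HC_set /= -/(im0 x) -/(im0 (aff l a b t x)) im0_aff => x0.
by rewrite mulr_gt0.
Qed.

Lemma deck_pi l a b t x : deck l a b t -> HC_set x -> pi (aff l a b t x) = pi x.
Proof.
move=> [l0 [g Gg gE]] Hx; apply/esym/piE => //; first exact: aff_HC.
by exists g => //; rewrite gE.
Qed.

Definition lifted c (x : C2 R) := A c /\
  \forall y \near x, [/\ HC_set y, dom c (pi y) & coord c (pi y) = y].

Lemma lifted_exists x : HC_set x -> exists c, lifted c x.
Proof. by move=> /(chart_exists D)[c Ac H]; exists c. Qed.

Lemma lifted_near c x : lifted c x -> \forall y \near x, lifted c y.
Proof. by move=> [Ac /near_join]; apply: filterS => y. Qed.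

Lemma lifted_in c x : lifted c x -> (coord c @` dom c) x.
Proof. by move=> [_ /nbhs_singleton[_ dx cx]]; exists (pi x). Qed.

Lemma lifted_nbhs c x : lifted c x -> nbhs x (coord c @` dom c).
Proof. by move=> /lifted_near; apply: filterS => y /lifted_in. Qed.

(** If c inverts the quotient map near x and c' does so near gamma x, then the
    change of charts is gamma. *)
Lemma lifted_change c c' l a b t x : deck l a b t ->
  lifted c x -> lifted c' (aff l a b t x) ->
  (coord c @` (dom c `&` dom c')) x /\
  \forall y \near x, change c c' y = aff l a b t y.
Proof.
move=> dk lc [Ac' lc'].
have [Ac lcN] := lc.
have param_pi : param c = pi by case: Ac.
have HN : \forall y \near x, [/\ HC_set (aff l a b t y), dom c' (pi (aff l a b t y))
    & coord c' (pi (aff l a b t y)) = aff l a b t y].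
  exact: (@aff_continuous _ l a b t x _ lc').
split.
  have [Hx dx cx] := nbhs_singleton lcN; have [_ dx' _] := nbhs_singleton HN.
  by exists (pi x) => //; split=> //; rewrite -(deck_pi dk Hx).
apply: filterS (filterI lcN HN) => y [[Hy _ _] [_ _ cy]].
by rewrite /change param_pi /= -(deck_pi dk Hy).
Qed.

Lemma deck1 : deck 1 0 0 0.
Proof.
split=> //; exists id; first exact: generated_id.
by move=> x Hx; rewrite toHC_val //; apply: C2_ext; rewrite /aff !mxE /=; ring.
Qed.
Lemma aff1 (x : C2 R) : aff 1 0 0 0 x = x.
Proof. by apply: C2_ext; rewrite /aff !mxE /=; ring. Qed.
Lemma daff1 (x : C2 R) : daff 1 0 x = x.
Proof. by apply: C2_ext; rewrite /daff !mxE /=; ring. Qed.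

Section Tensor2.
Variable omega : tensor2 R (inoue_surface D).
Hypothesis tomega : is_tensor2 A omega.

(** The common value in the charts that invert the quotient map near x; these do
    not form a type with a canonical element, whence the choice. *)
Definition pullback2 (u v x : C2 R) : R :=
  xget 0 [set r | exists2 c, lifted c x & r = omega c x u v].

Lemma tensor2_deck c c' l a b t x u v : deck l a b t ->
  lifted c x -> lifted c' (aff l a b t x) ->
  omega c x u v = omega c' (aff l a b t x) (daff l b u) (daff l b v).
Proof.
move=> dk lc lc'; have [inx ch] := lifted_change dk lc lc'.
rewrite (tensor2_change tomega u v lc.1 lc'.1 inx) (nbhs_singleton ch).
by have [-> _] := near_aff_diff ch.
Qed.

Lemma pullback2E c x u v : lifted c x -> pullback2 u v x = omega c x u v.
Proof.
move=> lc; rewrite /pullback2; case: xgetP => [r _ [c' lc' ->]|/(_ (omega c x u v))]; last by case; exists c.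
have lc1 : lifted c (aff 1 0 0 0 x) by rewrite aff1.
by rewrite (tensor2_deck u v deck1 lc' lc1) aff1 !daff1.
Qed.

Lemma pullback2_deck l a b t x u v : deck l a b t -> HC_set x ->
  pullback2 (daff l b u) (daff l b v) (aff l a b t x) = pullback2 u v x.
Proof.
move=> dk Hx; have [c lc] := lifted_exists Hx.
have [c' lc'] := lifted_exists (aff_HC a b t dk.1 Hx).
by rewrite (pullback2E _ _ lc) (pullback2E _ _ lc') -(tensor2_deck u v dk lc lc').
Qed.

Lemma pullback2_near c x u v : lifted c x -> \forall y \near x, pullback2 u v y = omega c y u v.
Proof. by move=> /lifted_near; apply: filterS => y; exact: pullback2E. Qed.

Lemma pullback2_C1 x u v : HC_set x -> C1_at (pullback2 u v) x.
Proof.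
move=> Hx; have [c lc] := lifted_exists Hx.
apply: (@near_eq_C1 _ (fun y => omega c y u v)).
  by have := pullback2_near u v lc; apply: filterS => y.
exact: Ck_on_C1 (tensor2_smooth tomega u v lc.1 1%N) (lifted_nbhs lc).
Qed.

Lemma pullback2_linearl x v : HC_set x -> real_linear (fun u => pullback2 u v x).
Proof.
move=> Hx s u1 u2; have [c lc] := lifted_exists Hx; rewrite !(pullback2E _ _ lc).
exact: (tensor2_linearl tomega v lc.1 (lifted_in lc)).
Qed.

End Tensor2.

Section Tensor1.
Variable eta : tensor1 R (inoue_surface D).
Hypothesis teta : is_one_form A eta.

Definition pullback1 (u x : C2 R) : R :=
  xget 0 [set r | exists2 c, lifted c x & r = eta c x u].

Lemma tensor1_deck c c' l a b t x u : deck l a b t ->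
  lifted c x -> lifted c' (aff l a b t x) ->
  eta c x u = eta c' (aff l a b t x) (daff l b u).
Proof.
move=> dk lc lc'; have [inx ch] := lifted_change dk lc lc'.
rewrite (one_form_change teta u lc.1 lc'.1 inx) (nbhs_singleton ch).
by have [-> _] := near_aff_diff ch.
Qed.

Lemma pullback1E c x u : lifted c x -> pullback1 u x = eta c x u.
Proof.
move=> lc; rewrite /pullback1; case: xgetP => [r _ [c' lc' ->]|/(_ (eta c x u))]; last by case; exists c.
have lc1 : lifted c (aff 1 0 0 0 x) by rewrite aff1.
by rewrite (tensor1_deck u deck1 lc' lc1) aff1 !daff1.
Qed.

Lemma pullback1_deck l a b t x u : deck l a b t -> HC_set x ->
  pullback1 (daff l b u) (aff l a b t x) = pullback1 u x.
Proof.
move=> dk Hx; have [c lc] := lifted_exists Hx.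
have [c' lc'] := lifted_exists (aff_HC a b t dk.1 Hx).
by rewrite (pullback1E _ lc) (pullback1E _ lc') -(tensor1_deck u dk lc lc').
Qed.

Lemma pullback1_near c x u : lifted c x -> \forall y \near x, pullback1 u y = eta c y u.
Proof. by move=> /lifted_near; apply: filterS => y; exact: pullback1E. Qed.

Lemma pullback1_C1 x u : HC_set x -> C1_at (pullback1 u) x.
Proof.
move=> Hx; have [c lc] := lifted_exists Hx.
apply: (@near_eq_C1 _ (fun y => eta c y u)).
  by have := pullback1_near u lc; apply: filterS => y.
exact: Ck_on_C1 (one_form_smooth teta u lc.1 1%N) (lifted_nbhs lc).
Qed.

Lemma pullback1_linear x : HC_set x -> real_linear (fun u => pullback1 u x).
Proof.
move=> Hx s u1 u2; have [c lc] := lifted_exists Hx; rewrite !(pullback1E _ lc).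
exact: (one_form_linear teta lc.1 (lifted_in lc)).
Qed.

Lemma pullback1_closed x u v : is_closed1 A eta -> HC_set x ->
  real_derive (pullback1 v) x u = real_derive (pullback1 u) x v.
Proof.
move=> cl Hx; have [c lc] := lifted_exists Hx.
rewrite (near_eq_real_derive _ (pullback1_near v lc)) (near_eq_real_derive _ (pullback1_near u lc)).
by have /eqP := cl c x u v lc.1 (lifted_in lc); rewrite /d1 subr_eq0 => /eqP.
Qed.

Lemma pullback1_primitive U f x : is_primitive_on A U f eta -> open U ->
  HC_set x -> U (pi x) ->
  C1_at (f \o pi) x /\ forall u, real_derive (f \o pi) x u = pullback1 u x.
Proof.
move=> [sf df] oU Hx Ux; have [c lc] := lifted_exists Hx.
have param_pi : param c = pi by case: (lc.1).
have UN : \forall y \near x, U (pi y).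
  by apply: (inoue_pi_continuous Hx); exact: open_nbhs_nbhs.
have inN : \forall y \near x, (coord c @` (dom c `&` U)) y.
  apply: filterS (filterI UN lc.2) => y [Uy [Hy dy cy]].
  by exists (pi y).
split; first by rewrite -param_pi; exact: Ck_on_C1 (sf c lc.1 1%N) inN.
move=> u; rewrite (pullback1E _ lc) -param_pi.
exact: df lc.1 (nbhs_singleton inN).
Qed.

End Tensor1.

End Pullback.

(** * A primitive of a closed form *)

Section Poincare.
Variables (R : realType) (E : C2 R -> C2 R -> R).
Hypothesis E_C1 : forall u x, HC_set x -> C1_at (E u) x.
Hypothesis E_linear : forall x, HC_set x -> real_linear (E^~ x).
Hypothesis E_closed : forall u v x, HC_set x ->
  real_derive (E v) x u = real_derive (E u) x v.

Let x0 : C2 R := pt 'i%C 0.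

Lemma HC_near (x : C2 R) : HC_set x -> \forall y \near x, HC_set y.
Proof. by move=> Hx; exact: open_nbhs_nbhs (conj (@HC_set_open R) Hx). Qed.

Lemma is_derive_line_scale (f : C2 R -> R) y u (s e : R) :
  line_derivable f (y + ((s * e)%:C%C : Cx R) *: u) ->
  is_derive e 1 (fun e => f (y + ((s * e)%:C%C : Cx R) *: u))
    (real_derive f (y + ((s * e)%:C%C : Cx R) *: u) u * s).
Proof.
move=> /line_is_derive_at df.
apply: (@is_derive1_comp _ (real_line f y u) (fun e => s * e)).
have := is_deriveZ s (is_derive_id e (1 : R)).
by rewrite /GRing.scale /= mulr1.
Qed.

(** For q = (s, e), the point of parameter s of the segment from x to x + v + e u. *)
Definition homotopy (x v u : C2 R) (q : R * R) : C2 R :=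
  x + (q.1%:C%C : Cx R) *: v + ((q.1 * q.2)%:C%C : Cx R) *: u.

Lemma homotopy_continuous x v u : continuous (homotopy x v u).
Proof.
move=> q0.
have H (h : C2 R -> R) : (forall x u (s : R), h (x + (s%:C%C : Cx R) *: u) = h x + s * h u) ->
    {for q0, continuous (h \o homotopy x v u)}.
  move=> hE.
  rewrite (_ : h \o _ = fun q : R * R => h x + q.1 * h v + q.1 * q.2 * h u).
    apply: continuousD; first apply: continuousD; first exact: cst_continuous.
      by apply: continuousM; [exact: cvg_fst|exact: cst_continuous].
    apply: continuousM; last exact: cst_continuous.
    by apply: continuousM; [exact: cvg_fst|exact: cvg_snd].
  by apply/funext => q; rewrite /= /homotopy hE hE.
by apply: C2_continuous_at; apply: H => *; [exact: re0_line|exact: im0_line|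
  exact: re1_line|exact: im1_line].
Qed.

Definition primitive (x : C2 R) : R :=
  segint 0 1 (fun s => E (x - x0) (x0 + (s%:C%C : Cx R) *: (x - x0))).

(** Differentiate under the integral sign. As the form is closed, the derivative
    of the integrand is that of s E u (x0 + s (x - x0)) with respect to s. *)
Lemma primitive_derive x u : HC_set x ->
  is_derive (0 : R) 1 (real_line primitive x u) (E u x).
Proof.
move=> Hx; set v := x - x0.
pose g s e := homotopy x0 v u (s, e).
have gHC : \forall e \near (0 : R), forall s : R, 0 <= s <= 1 -> HC_set (g s e).
  have := near_line u (HC_near Hx); apply: filterS => e He s /andP[s0 s1].
  have i0 : im0 x0 = 1 :> R by rewrite /im0 /x0 pt0.
  have iv : im0 v = im0 x - 1.
    have := im0_line x0 v 1; rewrite mul1r scale1r i0 /v addrC subrK => ->.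
    by rewrite addrAC subrr add0r.
  have : 0 < im0 x + e * im0 u by rewrite -(im0_line x u e).
  rewrite /HC_set /= -/(im0 (g s e)) /g /homotopy.
  rewrite (im0_line (x0 + (s%:C%C : Cx R) *: v) u (s * e)) (im0_line x0 v s) i0 iv.
  move=> h; rewrite (_ : _ + _ = (1 - s) + s * (im0 x + e * im0 u)); last by ring.
  have [->|sn] := eqVneq s 0; first by rewrite mul0r addr0 subr0.
  by rewrite ltr_wpDl ?subr_ge0 // mulr_gt0 // lt0r sn.
pose phi s e := E v (g s e) + e * E u (g s e).
pose rho s e := real_derive (E v) (g s e) u * s
  + (e * (real_derive (E u) (g s e) u * s) + E u (g s e) * 1).
have phiE : \forall e \near (0 : R), segint 0 1 (fun s => phi s e) = real_line primitive x u e.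
  apply: filterS gHC => e He; rewrite /real_line /primitive.
  apply: eq_segint => s /He Hs.
  have -> : x + (e%:C%C : Cx R) *: u - x0 = (e%:C%C : Cx R) *: u + v.
    by rewrite addrAC addrC.
  have -> : x0 + (s%:C%C : Cx R) *: ((e%:C%C : Cx R) *: u + v) = g s e.
    rewrite /g /homotopy /= scalerDr scalerA -addrA; congr (_ + _).
    by rewrite addrC rmorphM.
  by rewrite E_linear // /phi addrC.
apply: near_eq_is_derive phiE _.
have cg (f : C2 R -> R) (s e : R) : {for g s e, continuous f} ->
    {for (s, e), continuous (fun q : R * R => f (g q.1 q.2))}.
  move=> cf; apply: (@continuous_comp _ _ _ (fun q : R * R => g q.1 q.2) f).
    rewrite (_ : (fun q : R * R => _) = homotopy x0 v u); last by apply/funext => -[].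
    exact: homotopy_continuous.
  exact: cf.
have cphi : \forall e \near (0 : R), jointly_continuous_at phi 0 1 e.
  apply: filterS gHC => e He s /He /E_C1 EC.
  apply: continuousD; first by apply: cg; case: (EC v).
  by apply: continuousM; [exact: cvg_snd|apply: cg; case: (EC u)].
have crho : \forall e \near (0 : R), jointly_continuous_at rho 0 1 e.
  apply: filterS gHC => e He s /He /E_C1 EC.
  apply: continuousD.
    apply: continuousM; last exact: cvg_fst.
    by apply: (cg (fun y => real_derive (E v) y u)); case: (EC v).
  apply: continuousD.
    apply: continuousM; first exact: cvg_snd.
    apply: continuousM; last exact: cvg_fst.
    by apply: (cg (fun y => real_derive (E u) y u)); case: (EC u).
  by apply: continuousM; [apply: cg; case: (EC u)|exact: cst_continuous].
have drho : \forall e \near (0 : R), forall s : R, 0 <= s <= 1 ->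
    is_derive (e : R) 1 (phi s) (rho s e).
  apply: filterS gHC => e He s /He /E_C1 EC.
  have dv : is_derive e 1 (fun e => E v (g s e)) (real_derive (E v) (g s e) u * s).
    have [_ l _] := EC v.
    exact: (@is_derive_line_scale (E v) (x0 + (s%:C%C : Cx R) *: v) u s e l).
  have du : is_derive e 1 (fun e => E u (g s e)) (real_derive (E u) (g s e) u * s).
    have [_ l _] := EC u.
    exact: (@is_derive_line_scale (E u) (x0 + (s%:C%C : Cx R) *: v) u s e l).
  have := is_deriveD dv (is_deriveM (is_derive_id e (1 : R)) du).
  by rewrite /GRing.scale /=.
have := is_derive_segint_param ler01 cphi crho drho.
suff -> : segint 0 1 (rho^~ 0) = E u x by [].
have g0 s : g s 0 = x0 + (s%:C%C : Cx R) *: v.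
  by rewrite /g /homotopy /= mulr0 line0.
have gHC0 := nbhs_singleton gHC.
pose Psi (s : R) := s * E u (x0 + (s%:C%C : Cx R) *: v).
have dPsi (s : R) : 0 <= s <= 1 -> is_derive s 1 Psi (rho s 0).
  move=> abs; have Hs := gHC0 _ abs; rewrite g0 in Hs.
  have [_ du _] := E_C1 u Hs.
  have := is_deriveM (is_derive_id s (1 : R)) (line_is_derive_at du (u := v)).
  rewrite /GRing.scale /= /rho mul0r add0r g0 (E_closed u v Hs) => dd.
  by apply: is_derive_eq dd _; rewrite mulrC.
rewrite (segint_FTC ltr01 (jointly_continuous_segment (nbhs_singleton crho)) dPsi).
by rewrite /Psi mul1r mul0r subr0 scale1r /v addrC subrK.
Qed.

End Poincare.

(** * Functions invariant under the Heisenberg lattice *)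

Section RealPoints.
Variable R : realType.

Definition real_pt (a b c d : R) : C2 R := pt (a +i* b)%C (c +i* d)%C.
Lemma re0_real_pt a b c d : re0 (real_pt a b c d) = a. Proof. by rewrite /re0 pt0. Qed.
Lemma im0_real_pt a b c d : im0 (real_pt a b c d) = b. Proof. by rewrite /im0 pt0. Qed.
Lemma re1_real_pt a b c d : re1 (real_pt a b c d) = c. Proof. by rewrite /re1 pt1. Qed.
Lemma im1_real_pt a b c d : im1 (real_pt a b c d) = d. Proof. by rewrite /im1 pt1. Qed.
Definition real_ptE := (re0_real_pt, im0_real_pt, re1_real_pt, im1_real_pt).

Lemma real_pt_eta (x : C2 R) : real_pt (re0 x) (im0 x) (re1 x) (im1 x) = x.
Proof. by apply: C2_eqP; rewrite real_ptE. Qed.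

Lemma real_pt_HC a b c d : HC_set (real_pt a b c d) = (0 < b) :> Prop.
Proof. by rewrite /HC_set /= -/(im0 (real_pt a b c d)) im0_real_pt. Qed.

Lemma real_pt_line a b c d a' b' c' d' (s : R) :
  real_pt a b c d + (s%:C%C : Cx R) *: real_pt a' b' c' d' =
  real_pt (a + s * a') (b + s * b') (c + s * c') (d + s * d').
Proof.
apply: C2_eqP.
- by rewrite re0_line (re0_real_pt a) (re0_real_pt a') re0_real_pt.
- by rewrite im0_line (im0_real_pt a) (im0_real_pt a') im0_real_pt.
- by rewrite re1_line (re1_real_pt a) (re1_real_pt a') re1_real_pt.
- by rewrite im1_line (im1_real_pt a) (im1_real_pt a') im1_real_pt.
Qed.

Lemma real_pt_continuous (T : topologicalType) (a b c d : T -> R) t :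
  {for t, continuous a} -> {for t, continuous b} -> {for t, continuous c} ->
  {for t, continuous d} -> {for t, continuous (fun t => real_pt (a t) (b t) (c t) (d t))}.
Proof.
move=> ca cb cc cd; apply: C2_continuous_at.
- by rewrite (_ : _ \o _ = a) //; apply/funext => s; rewrite /= re0_real_pt.
- by rewrite (_ : _ \o _ = b) //; apply/funext => s; rewrite /= im0_real_pt.
- by rewrite (_ : _ \o _ = c) //; apply/funext => s; rewrite /= re1_real_pt.
- by rewrite (_ : _ \o _ = d) //; apply/funext => s; rewrite /= im1_real_pt.
Qed.

Lemma aff_real_pt l a' b' (t : R) a b c d :
  aff l a' b' (t%:C%C) (real_pt a b c d) = real_pt (l * a + a') (l * b) (c + b' * a + t) (d + b' * b).
Proof.
by apply: C2_eqP; rewrite (re0_aff, im0_aff, re1_aff, im1_aff) !real_ptE //= addr0.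
Qed.

End RealPoints.

Section Reduction.
Variables (R : realType) (D : inoue_data R) (f : C2 R -> R).
Local Notation a1 := (ia D 0 0).
Local Notation a2 := (ia D 0 1).
Local Notation b1 := (ib D 0 0).
Local Notation b2 := (ib D 0 1).
Local Notation kappa := (inoue_kappa (ia D) (ib D) (ir D)).
Hypothesis f_cont : forall x, HC_set x -> {for x, continuous f}.
Hypothesis f_phi : forall i x, HC_set x ->
  f (aff 1 (ia D 0 i) (ib D 0 i) ((ic D 0 i)%:C%C) x) = f x.
Hypothesis f_phi3 : forall x, HC_set x -> f (aff 1 0 0 (kappa%:C%C) x) = f x.

(** The action of phi_i on (Re w, Im z / Im w) is the translation by (a_i, b_i). It
    suffices to know that Re z becomes some s', as phi_3 translates it separately. *)
Lemma reduce_phi i (m : int) r y u (s : R) : 0 < y -> exists s',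
  f (real_pt r y s (y * u)) = f (real_pt (r + m%:~R * ia D 0 i) y s' (y * (u + m%:~R * ib D 0 i))).
Proof.
move=> y0.
have step r' u' s' : f (real_pt r' y s' (y * u')) =
    f (real_pt (r' + ia D 0 i) y (s' + ib D 0 i * r' + ic D 0 i) (y * (u' + ib D 0 i))).
  rewrite -(f_phi i); last by rewrite real_pt_HC.
  by rewrite aff_real_pt !mul1r; congr (f (real_pt _ _ _ _)); ring.
elim: m => [|m [s' IH]|m [s' IH]].
- by exists s; rewrite !mul0r !addr0.
- exists (s' + ib D 0 i * (r + m%:~R * ia D 0 i) + ic D 0 i).
  by rewrite IH step; congr (f (real_pt _ _ _ _)); rewrite intS; ring.
- pose r' := r - m.+1%:~R * ia D 0 i.
  exists (s' - ic D 0 i - ib D 0 i * r').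
  by rewrite IH [RHS]step; congr (f (real_pt _ _ _ _)); rewrite /r' ?intS; ring.
Qed.

Lemma reduce_phi3 (m : int) r y z (s : R) : 0 < y ->
  f (real_pt r y s z) = f (real_pt r y (s + m%:~R * kappa) z).
Proof.
move=> y0.
have step s' : f (real_pt r y s' z) = f (real_pt r y (s' + kappa) z).
  rewrite -(f_phi3 (x := real_pt r y s' z)); last by rewrite real_pt_HC.
  by rewrite aff_real_pt !mul1r; congr (f (real_pt _ _ _ _)); ring.
elim: m => [|m IH|m IH].
- by rewrite !mul0r !addr0.
- by rewrite IH step; congr (f (real_pt _ _ _ _)); rewrite intS; ring.
- by rewrite [RHS]step IH; congr (f (real_pt _ _ _ _)); rewrite ?intS; ring.
Qed.

Definition box_point (p : R * R * R * R) : C2 R :=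
  real_pt (p.1.1.1 * a1 + p.1.1.2 * a2) p.2 (p.1.2 * kappa)
      (p.2 * (p.1.1.1 * b1 + p.1.1.2 * b2)).

Lemma floor_frac (s : R) : exists m : int, 0 <= s + m%:~R <= 1.
Proof.
exists (- Num.floor s); have /andP[h1 h2] := floor_itv s.
by rewrite rmorphN /=; rewrite rmorphD /= in h2; apply/andP; split; lra.
Qed.

Lemma reduce_box x : HC_set x -> exists s1 s2 c,
  [/\ 0 <= s1 <= 1, 0 <= s2 <= 1, 0 <= c <= 1 & f x = f (box_point (s1, s2, c, im0 x))].
Proof.
move=> Hx; have y0 : 0 < im0 x by [].
have D0 := ia_ib_det_neq0 D; have k0 := kappa_neq0 D.
pose Dt := b1 * a2 - b2 * a1; rewrite -/Dt in D0.
pose u := im1 x / im0 x; pose r := re0 x.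
pose s1 := (u * a2 - r * b2) / Dt; pose s2 := (r * b1 - u * a1) / Dt.
have [m1 h1] := floor_frac s1; have [m2 h2] := floor_frac s2.
have [t1 e1] := reduce_phi 0 m1 r u (re1 x) y0.
have [t2 e2] := reduce_phi 1 m2 (r + m1%:~R * a1) (u + m1%:~R * b1) t1 y0.
have [k hk] := floor_frac (t2 / kappa).
have e3 := reduce_phi3 k (r + m1%:~R * a1 + m2%:~R * a2)
  (im0 x * (u + m1%:~R * b1 + m2%:~R * b2)) t2 y0.
exists (s1 + m1%:~R), (s2 + m2%:~R), (t2 / kappa + k%:~R); split => //.
have xE : x = real_pt r (im0 x) (re1 x) (im0 x * u).
  by rewrite /u mulrC divfK ?gt_eqF // real_pt_eta.
rewrite {1}xE e1 e2 e3 /box_point /=; congr (f (real_pt _ _ _ _)).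
- by rewrite /s1 /s2 /Dt; field.
- by field.
- by rewrite /s1 /s2 /Dt; field.
Qed.

Lemma box_point_continuous : continuous box_point.
Proof.
move=> p.
have c1 : {for p, continuous (fun p : R * R * R * R => p.1.1.1)}.
  apply: (@continuous_comp _ _ _ (fun p : R * R * R * R => p.1.1) fst); last exact: cvg_fst.
  by apply: (@continuous_comp _ _ _ (fun p : R * R * R * R => p.1) fst); exact: cvg_fst.
have c2 : {for p, continuous (fun p : R * R * R * R => p.1.1.2)}.
  apply: (@continuous_comp _ _ _ (fun p : R * R * R * R => p.1.1) snd); last exact: cvg_snd.
  by apply: (@continuous_comp _ _ _ (fun p : R * R * R * R => p.1) fst); exact: cvg_fst.
have c3 : {for p, continuous (fun p : R * R * R * R => p.1.2)}.
  by apply: (@continuous_comp _ _ _ (fun p : R * R * R * R => p.1) snd); [exact: cvg_fst|exact: cvg_snd].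
have c4 : {for p, continuous (fun p : R * R * R * R => p.2)} by exact: cvg_snd.
suff : {for p, continuous (fun p : R * R * R * R => real_pt (p.1.1.1 * a1 + p.1.1.2 * a2) p.2
    (p.1.2 * kappa) (p.2 * (p.1.1.1 * b1 + p.1.1.2 * b2)))} by [].
apply: real_pt_continuous => //.
- by apply: continuousD; apply: continuousM => //; exact: cst_continuous.
- by apply: continuousM => //; exact: cst_continuous.
- apply: continuousM => //.
  by apply: continuousD; apply: continuousM => //; exact: cst_continuous.
Qed.

Definition unit_box (y0 y1 : R) : set (R * R * R * R) :=
  `[0, 1] `*` `[0, 1] `*` `[0, 1] `*` `[y0, y1].

Lemma unit_box_compact y0 y1 : compact (unit_box y0 y1).
Proof. by do 3?apply: compact_setX; exact: segment_compact. Qed.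

(** Modulo the lattice, the slab y0 <= Im w <= y1 is the image of a compact box, on
    which a continuous function reaches its bounds. *)
Lemma invariant_minmax y0 y1 : 0 < y0 -> y0 <= y1 -> exists x1 x2,
  [/\ HC_set x1, HC_set x2 & forall x, y0 <= im0 x <= y1 -> f x1 <= f x <= f x2].
Proof.
move=> y00 y01.
have ne : unit_box y0 y1 !=set0.
  by exists (0, 0, 0, y0); rewrite /unit_box /= !in_itv /= !lexx !ler01 y01.
have HCb p : unit_box y0 y1 p -> HC_set (box_point p).
  rewrite /unit_box /= !in_itv /= => -[_ /andP[h _]].
  by rewrite real_pt_HC (lt_le_trans y00).
have cont : {within unit_box y0 y1, continuous (f \o box_point)}.
  apply: continuous_in_subspaceT => p /set_mem Bp.
  apply: continuous_comp; first exact: box_point_continuous.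
  exact: f_cont (HCb _ Bp).
have [p1 /set_mem B1 m1] := compact_EVT_min ne (@unit_box_compact y0 y1) cont.
have [p2 /set_mem B2 m2] := compact_EVT_max ne (@unit_box_compact y0 y1) cont.
exists (box_point p1), (box_point p2); split; [exact: HCb|exact: HCb|].
move=> x hx; have Hx : HC_set x.
  by rewrite /HC_set /= -/(im0 x); case/andP: hx => h _; exact: lt_le_trans h.
have [s1 [s2 [c [h1 h2 h3 ->]]]] := reduce_box Hx.
have B : unit_box y0 y1 (s1, s2, c, im0 x) by rewrite /unit_box /= !in_itv /= h1 h2 h3.
by apply/andP; split; [exact/m1/mem_set|exact/m2/mem_set].
Qed.

End Reduction.

(** * Conservation of flux *)

(** W stands for exp(- F) omega, where F is a primitive of the Lee form. *)
Section Flux.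
Variables (R : realType) (D : inoue_data R) (W : C2 R -> C2 R -> C2 R -> R) (chi : R).
Local Notation al := (ialpha D).
Local Notation kappa := (inoue_kappa (ia D) (ib D) (ir D)).
Local Notation ez := (real_pt 0 0 1 0 : C2 R).
Local Notation iz := (real_pt 0 0 0 1 : C2 R).
Local Notation V0 := (real_pt 0 1 0 0 : C2 R).
Hypothesis W_C1 : forall u v x, HC_set x -> C1_at (W u v) x.
Hypothesis W_linl : forall v x, HC_set x -> real_linear (fun u => W u v x).
Hypothesis W_anti : forall u v x, HC_set x -> W u v x = - W v u x.
Hypothesis W_closed : forall u v w x, HC_set x ->
  real_derive (W v w) x u - real_derive (W u w) x v + real_derive (W u v) x w = 0.
Hypothesis W_pos : forall x, HC_set x -> 0 < W ez iz x.
Hypothesis W_phi : forall i u v x, HC_set x ->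
  W (daff 1 (ib D 0 i) u) (daff 1 (ib D 0 i) v)
    (aff 1 (ia D 0 i) (ib D 0 i) ((ic D 0 i)%:C%C) x) = W u v x.
Hypothesis W_phi3 : forall u v x, HC_set x -> W u v (aff 1 0 0 (kappa%:C%C) x) = W u v x.
Hypothesis chi_gt0 : 0 < chi.
Hypothesis W_phi0 : forall u v x, HC_set x ->
  W (daff al 0 u) (daff al 0 v) (aff al 0 0 (it D) x) = chi * W u v x.

(* below, A := A0 + u A1 and B := B0 + u B1 are the values of W on
   (vfield u, ez) and on (vfield u, iz) *)
Let q := W ez iz.
Let A0 := W V0 ez.
Let A1 := W iz ez.
Let B0 := W V0 iz.
Let B1 := W iz iz.

(** The slice Re w = 0 with coordinates s = Re z and p = (Im z / Im w, Im w). With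
    Im z / Im w instead of Im z, the lattice acts independently of Im w. *)
Definition slice (s : R) (p : R * R) : C2 R := real_pt 0 p.2 s (p.2 * p.1).
(** The direction of d/dy in [slice], where Re z and u = Im z / Im w are fixed. *)
Definition vfield (u : R) : C2 R := real_pt 0 1 0 u.

Lemma slice_HC s p : 0 < p.2 -> HC_set (slice s p).
Proof. by rewrite real_pt_HC. Qed.

Lemma vfieldE u : vfield u = (u%:C%C : Cx R) *: iz + V0.
Proof. by rewrite addrC real_pt_line /vfield !mulr0 !addr0 mulr1 add0r. Qed.

Lemma real_derive_lin (f g : C2 R -> R) (u : R) x d : line_derivable f x -> line_derivable g x ->
  real_derive (fun y => f y + u * g y) x d = real_derive f x d + u * real_derive g x d.
Proof.
move=> /line_is_derive -/(_ d) df /line_is_derive -/(_ d) dg.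
exact: real_derive_val (is_deriveD df (is_deriveZ u dg)).
Qed.

Lemma W_vfield u v x : HC_set x -> W (vfield u) v x = W V0 v x + u * W iz v x.
Proof. by move=> Hx; rewrite vfieldE W_linl // addrC. Qed.

Lemma real_derive_vfield u v x d : HC_set x ->
  real_derive (W (vfield u) v) x d = real_derive (W V0 v) x d + u * real_derive (W iz v) x d.
Proof.
move=> Hx; have [_ d0 _] := W_C1 V0 v Hx; have [_ d1 _] := W_C1 iz v Hx.
rewrite -real_derive_lin //; apply: near_eq_real_derive.
by have := HC_near Hx; apply: filterS => y; exact: W_vfield.
Qed.

Lemma slice_y (f : C2 R -> R) s u (y : R) : 0 < y -> (forall x, HC_set x -> C1_at f x) ->
  is_derive y 1 (fun y => f (slice s (u, y))) (real_derive f (slice s (u, y)) (vfield u)).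
Proof.
move=> y0 fC.
have E y' : slice s (u, y') = real_pt 0 0 s 0 + (y'%:C%C : Cx R) *: vfield u.
  by rewrite /vfield real_pt_line /slice /=; congr (real_pt _ _ _ _); ring.
have [_ df _] := fC _ (slice_HC s (p := (u, y)) y0).
rewrite E in df *; have := line_is_derive_at df.
rewrite (_ : real_line _ _ _ = fun y => f (slice s (u, y))) //.
by apply/funext => y'; rewrite E.
Qed.

Lemma slice_s (f : C2 R -> R) (s : R) u (y : R) : 0 < y -> (forall x, HC_set x -> C1_at f x) ->
  is_derive s 1 (fun s => f (slice s (u, y))) (real_derive f (slice s (u, y)) ez).
Proof.
move=> y0 fC.
have E s' : slice s' (u, y) = real_pt 0 y 0 (y * u) + (s'%:C%C : Cx R) *: ez.
  by rewrite real_pt_line /slice /=; congr (real_pt _ _ _ _); ring.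
have [_ df _] := fC _ (slice_HC s (p := (u, y)) y0).
rewrite E in df *; have := line_is_derive_at df.
rewrite (_ : real_line _ _ _ = fun s => f (slice s (u, y))) //.
by apply/funext => y'; rewrite E.
Qed.

Lemma slice_u (f : C2 R -> R) s (u : R) (y : R) : 0 < y -> (forall x, HC_set x -> C1_at f x) ->
  is_derive u 1 (fun u => f (slice s (u, y))) (real_derive f (slice s (u, y)) iz * y).
Proof.
move=> y0 fC.
have E u' : slice s (u', y) = real_pt 0 y s 0 + ((y * u')%:C%C : Cx R) *: iz.
  by rewrite real_pt_line /slice /=; congr (real_pt _ _ _ _); ring.
have [_ df _] := fC _ (slice_HC s (p := (u, y)) y0).
rewrite E in df *; have := is_derive_line_scale df.
rewrite (_ : (fun e => _) = fun u => f (slice s (u, y))) //.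
by apply/funext => y'; rewrite E.
Qed.

Definition continuous3 (Z : R -> R * R -> R) := forall s p, 0 < p.2 ->
  {for (s, p), continuous (fun q : R * (R * R) => Z q.1 q.2)}.

Lemma slice_continuous3 (f : C2 R -> R) : (forall x, HC_set x -> {for x, continuous f}) ->
  continuous3 (fun s p => f (slice s p)).
Proof.
move=> cf s p p0.
apply: (@continuous_comp _ _ _ (fun q : R * (R * R) => slice q.1 q.2) f); last first.
  by apply: cf; exact: slice_HC.
have cs : {for (s, p), continuous (fun q : R * (R * R) => q.1)} by exact: cvg_fst.
have cu : {for (s, p), continuous (fun q : R * (R * R) => q.2.1)}.
  by apply: (@continuous_comp _ _ _ (fun q : R * (R * R) => q.2) fst); [exact: cvg_snd|exact: cvg_fst].
have cy : {for (s, p), continuous (fun q : R * (R * R) => q.2.2)}.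
  by apply: (@continuous_comp _ _ _ (fun q : R * (R * R) => q.2) snd); [exact: cvg_snd|exact: cvg_snd].
apply: real_pt_continuous => //; first exact: cst_continuous.
exact: continuousM.
Qed.

Lemma continuous3D Z Z' : continuous3 Z -> continuous3 Z' ->
  continuous3 (fun s p => Z s p + Z' s p).
Proof. by move=> c c' s p p0; apply: continuousD; [exact: c|exact: c']. Qed.
Lemma continuous3B Z Z' : continuous3 Z -> continuous3 Z' ->
  continuous3 (fun s p => Z s p - Z' s p).
Proof. by move=> c c' s p p0; apply: continuousB; [exact: c|exact: c']. Qed.
Lemma continuous3M Z Z' : continuous3 Z -> continuous3 Z' ->
  continuous3 (fun s p => Z s p * Z' s p).
Proof. by move=> c c' s p p0; apply: continuousM; [exact: c|exact: c']. Qed.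
Lemma continuous3_y : continuous3 (fun s p => p.2).
Proof.
by move=> s p p0; apply: (@continuous_comp _ _ _ (fun q : R * (R * R) => q.2) snd); exact: cvg_snd.
Qed.
Lemma continuous3_u : continuous3 (fun s p => p.1).
Proof.
move=> s p p0; apply: (@continuous_comp _ _ _ (fun q : R * (R * R) => q.2) fst).
  exact: cvg_snd.
exact: cvg_fst.
Qed.

Lemma continuous3_W u v : continuous3 (fun s p => W u v (slice s p)).
Proof. by apply: slice_continuous3 => x /(W_C1 u v)[]. Qed.
Lemma continuous3_dW u v d : continuous3 (fun s p => real_derive (W u v) (slice s p) d).
Proof. by apply: (@slice_continuous3 (fun x => real_derive (W u v) x d)) => x /(W_C1 u v)[]. Qed.

Lemma continuous3_joint Z a b p : continuous3 Z -> 0 < p.2 -> jointly_continuous_at Z a b p.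
Proof. by move=> cZ p0 s _; exact: cZ. Qed.

Lemma continuous3_joint_y Z a b u (y : R) : continuous3 Z -> 0 < y ->
  jointly_continuous_at (fun s y => Z s (u, y)) a b y.
Proof.
move=> cZ y0 s _.
apply: (@continuous_comp _ _ _ (fun q : R * R => (q.1, (u, q.2)) : R * (R * R))
  (fun q : R * (R * R) => Z q.1 q.2)); last exact: cZ.
have := @cvg_pair _ _ _ _ _ _ _ _ _ _ _ (@cvg_fst R R (nbhs s) (nbhs y) _) (@cvg_pair _ _ _ _ _ _ _ _ _ _ _ (cvg_cst (u : R)) (@cvg_snd R R (nbhs s) (nbhs y) _)).
exact.
Qed.

Lemma continuous3_joint_u Z a b (u : R) (y : R) : continuous3 Z -> 0 < y ->
  jointly_continuous_at (fun s u => Z s (u, y)) a b u.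
Proof.
move=> cZ y0 s _.
apply: (@continuous_comp _ _ _ (fun q : R * R => (q.1, (q.2, y)) : R * (R * R))
  (fun q : R * (R * R) => Z q.1 q.2)); last exact: cZ.
have := @cvg_pair _ _ _ _ _ _ _ _ _ _ _ (@cvg_fst R R (nbhs s) (nbhs u) _) (@cvg_pair _ _ _ _ _ _ _ _ _ _ _ (@cvg_snd R R (nbhs s) (nbhs u) _) (cvg_cst (y : R))).
exact.
Qed.

Let A_slice s (p : R * R) := A0 (slice s p) + p.1 * A1 (slice s p).
Let B_slice s (p : R * R) := B0 (slice s p) + p.1 * B1 (slice s p).
Let dA s (p : R * R) := real_derive A0 (slice s p) iz * p.2
  + (p.1 * (real_derive A1 (slice s p) iz * p.2) + A1 (slice s p)).
Let dB s (p : R * R) := real_derive B0 (slice s p) ez + p.1 * real_derive B1 (slice s p) ez.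
Let yq s (p : R * R) := p.2 * q (slice s p).
Let dyq s (p : R * R) := p.2 * dB s p - dA s p.

Lemma A_slice_derive s (u y : R) : 0 < y -> is_derive u 1 (fun u => A_slice s (u, y)) (dA s (u, y)).
Proof.
move=> y0.
have d0 := slice_u s u y0 (@W_C1 V0 ez); have d1 := slice_u s u y0 (@W_C1 iz ez).
have := is_deriveD d0 (is_deriveM (is_derive_id u (1 : R)) d1).
by rewrite /GRing.scale /= mulr1.
Qed.

Lemma B_slice_derive (s : R) u (y : R) : 0 < y -> is_derive s 1 (fun s => B_slice s (u, y)) (dB s (u, y)).
Proof.
move=> y0.
have d0 := slice_s s u y0 (@W_C1 V0 iz); have d1 := slice_s s u y0 (@W_C1 iz iz).
exact: is_deriveD d0 (is_deriveZ u d1).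
Qed.

(** As W is closed, on [vfield u] and the two directions of the z-axis, the
    derivative of q along [vfield u] is the difference of those of B and A in the
    other two directions, with u fixed in the coefficients. The term q from the
    factor y is the term - A1 from the factor u of A. *)
Lemma yq_derive s u (y : R) : 0 < y -> is_derive y 1 (fun y => yq s (u, y)) (dyq s (u, y)).
Proof.
move=> y0.
have Hx : HC_set (slice s (u, y)) by exact: slice_HC.
have d0 := slice_y s u y0 (@W_C1 ez iz).
have := is_deriveM (is_derive_id y (1 : R)) d0.
rewrite /GRing.scale /= mulr1 => d1.
apply: is_derive_eq d1 _.
have e1 := real_derive_vfield u iz ez Hx.
have e2 := real_derive_vfield u ez iz Hx.
have e : real_derive (W ez iz) (slice s (u, y)) (vfield u)
    - (real_derive B0 (slice s (u, y)) ez + u * real_derive B1 (slice s (u, y)) ez)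
    + (real_derive A0 (slice s (u, y)) iz + u * real_derive A1 (slice s (u, y)) iz) = 0.
  exact: (eq_trans (f_equal2 (fun b c => real_derive (W ez iz) (slice s (u, y)) (vfield u) - b + c)
    (esym e1) (esym e2)) (W_closed (vfield u) ez iz Hx)).
have alg (dq a0 a1 b0 b1 q0 a : R) : dq - (b0 + u * b1) + (a0 + u * a1) = 0 ->
    q0 = - a -> y * dq + q0 = y * (b0 + u * b1) - (a0 * y + (u * (a1 * y) + a)).
  move=> h ->; rewrite -[RHS]addr0 -(mulr0 y) -h; ring.
exact: (alg _ _ _ _ _ _ _ e (W_anti ez iz Hx)).
Qed.

Lemma A_slice_continuous : continuous3 A_slice.
Proof.
apply: continuous3D; first exact: continuous3_W.
by apply: continuous3M; [exact: continuous3_u|exact: continuous3_W].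
Qed.
Lemma dB_continuous : continuous3 dB.
Proof.
apply: continuous3D; first exact: continuous3_dW.
by apply: continuous3M; [exact: continuous3_u|exact: continuous3_dW].
Qed.
Lemma dA_continuous : continuous3 dA.
Proof.
apply: continuous3D.
  by apply: continuous3M; [exact: continuous3_dW|exact: continuous3_y].
apply: continuous3D; last exact: continuous3_W.
apply: continuous3M; first exact: continuous3_u.
by apply: continuous3M; [exact: continuous3_dW|exact: continuous3_y].
Qed.
Lemma yq_continuous : continuous3 yq.
Proof. by apply: continuous3M; [exact: continuous3_y|exact: continuous3_W]. Qed.
Lemma dyq_continuous : continuous3 dyq.
Proof.
apply: continuous3B; last exact: dA_continuous.
by apply: continuous3M; [exact: continuous3_y|exact: dB_continuous].
Qed.

Let K := `|kappa|.
Lemma K_gt0 : 0 < K. Proof. by rewrite normr_gt0 kappa_neq0. Qed.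

Lemma B_slice_period u y : 0 < y -> B_slice K (u, y) = B_slice 0 (u, y).
Proof.
move=> y0.
have per s : B_slice (s + kappa) (u, y) = B_slice s (u, y).
  have Hx : HC_set (slice s (u, y)) by exact: slice_HC.
  have E : slice (s + kappa) (u, y) = aff 1 0 0 (kappa%:C%C) (slice s (u, y)).
    by rewrite aff_real_pt /slice /=; congr (real_pt _ _ _ _); ring.
  by rewrite /B_slice E /B0 /B1 !W_phi3.
rewrite /K; case: (ger0P kappa) => _; first by rewrite -[X in B_slice X]add0r per.
by rewrite -per addNr.
Qed.

Lemma pos_near (y : R) : 0 < y -> \forall y' \near y, 0 < y'.
Proof. by move=> y0; apply: open_nbhs_nbhs; split => //; exact: open_gt. Qed.

Lemma pos_near2 (u y : R) : 0 < y -> \forall p \near ((u, y) : R * R), 0 < p.2.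
Proof. by move=> /pos_near; exact: (@cvg_snd R R (nbhs u) (nbhs y) _). Qed.

Let int_dA (p : R * R) := segint 0 K (fun s => dA s p).
Let int_A (p : R * R) := segint 0 K (fun s => A_slice s p).
Let int_yq (p : R * R) := segint 0 K (fun s => yq s p).

Lemma int_A_derive (u y : R) : 0 < y -> is_derive u 1 (fun u => int_A (u, y)) (int_dA (u, y)).
Proof.
move=> y0; apply: (@is_derive_segint_param _ (fun s u => A_slice s (u, y)) (fun s u => dA s (u, y))).
- exact: ltW K_gt0.
- by apply: (@filterE _ (nbhs u)) => u'; exact: continuous3_joint_u A_slice_continuous y0.
- by apply: (@filterE _ (nbhs u)) => u'; exact: continuous3_joint_u dA_continuous y0.
- by apply: (@filterE _ (nbhs u)) => u' s _; exact: A_slice_derive.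
Qed.

(** The derivative of B in s integrates to 0 over a period of phi_3. *)
Lemma int_yq_derive (u y : R) : 0 < y -> is_derive y 1 (fun y => int_yq (u, y)) (- int_dA (u, y)).
Proof.
move=> y0.
have d : is_derive y 1 (fun y => int_yq (u, y)) (segint 0 K (fun s => dyq s (u, y))).
  apply: (@is_derive_segint_param _ (fun s y => yq s (u, y)) (fun s y => dyq s (u, y))).
  - exact: ltW K_gt0.
  - by have := pos_near y0; apply: filterS => y'; exact: continuous3_joint_y yq_continuous.
  - by have := pos_near y0; apply: filterS => y'; exact: continuous3_joint_y dyq_continuous.
  - by have := pos_near y0; apply: filterS => y' y'0 s _; exact: yq_derive.
apply: is_derive_eq d _.
have cdA : continuous_on_segment 0 K (fun s => dA s (u, y)).
  exact: jointly_continuous_segment (continuous3_joint (p := (u, y)) dA_continuous y0).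
have cdB : continuous_on_segment 0 K (fun s => y * dB s (u, y)).
  move=> s sK; apply: continuousM; first exact: cst_continuous.
  exact: (jointly_continuous_segment (continuous3_joint (p := (u, y)) dB_continuous y0) sK).
rewrite /dyq segintB // -/(int_dA (u, y)).
have dyB (s : R) : 0 <= s <= K -> is_derive s 1 (fun s => y * B_slice s (u, y)) (y * dB s (u, y)).
  by move=> _; have dBf := B_slice_derive s u y0; exact: (is_deriveZ y dBf).
by rewrite (segint_FTC K_gt0 cdB dyB) B_slice_period // subrr sub0r.
Qed.

Lemma segint_param_continuous Z (u y : R) : continuous3 Z -> 0 < y ->
  {for (u, y), continuous (fun p : R * R => segint 0 K (fun s => Z s p))}.
Proof.
move=> cZ y0; apply: (@continuous_segint_param _ _ Z); first exact: ltW K_gt0.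
by have := pos_near2 u y0; apply: filterS => p; exact: continuous3_joint.
Qed.

Let mass T y := segint 0 T (fun u => int_yq (u, y)).

(** What remains is a derivative in u, so only the two ends contribute. *)
Lemma mass_derive T (y : R) : 0 < T -> 0 < y ->
  is_derive y 1 (mass T) (- (int_A (T, y) - int_A (0, y))).
Proof.
move=> T0 y0.
have jc (Z : R -> R * R -> R) y' : continuous3 Z -> 0 < y' ->
    jointly_continuous_at (fun u y => segint 0 K (fun s => Z s (u, y))) 0 T y'.
  move=> cZ y'0 u _.
  rewrite (_ : (fun r : R * R => _) = (fun p : R * R => segint 0 K (fun s => Z s p))).
    exact: segint_param_continuous.
  by apply/funext => -[].
have jcN y' : 0 < y' -> jointly_continuous_at (fun u y => - int_dA (u, y)) 0 T y'.
  by move=> y'0 u uT; apply: continuousN; exact: (jc dA y' dA_continuous y'0).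
have d : is_derive y 1 (mass T) (segint 0 T (fun u => - int_dA (u, y))).
  apply: (@is_derive_segint_param _ (fun u y => int_yq (u, y)) (fun u y => - int_dA (u, y))).
  - exact: ltW.
  - by have := pos_near y0; apply: filterS => y' y'0; exact: jc yq_continuous y'0.
  - by have := pos_near y0; apply: filterS => y'; exact: jcN.
  - by have := pos_near y0; apply: filterS => y' y'0 u _; exact: int_yq_derive.
apply: is_derive_eq d _.
have dN (u : R) : 0 <= u <= T -> is_derive u 1 (fun u => - int_A (u, y)) (- int_dA (u, y)).
  by move=> _; exact: is_deriveN (int_A_derive u y0).
by rewrite (segint_FTC T0 (jointly_continuous_segment (jcN _ y0)) dN) opprK opprB addrC.
Qed.

(** The function A of the slice, extended to the universal cover: it is the value
    of W on [vfield (im1 x / im0 x)], which the lattice preserves, and on ez. *)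
Let Ainv (x : C2 R) := A0 x + im1 x / im0 x * A1 x.

Lemma Ainv_W x : HC_set x -> Ainv x = W (vfield (im1 x / im0 x)) ez x.
Proof. by move=> Hx; rewrite W_vfield. Qed.

Lemma Ainv_slice s u y : 0 < y -> Ainv (slice s (u, y)) = A_slice s (u, y).
Proof.
by move=> y0; rewrite /Ainv /A_slice /slice /= im0_real_pt im1_real_pt [y * u]mulrC mulfK ?gt_eqF.
Qed.

Lemma daff_iz l b : daff l b iz = iz.
Proof. by apply: C2_ext; rewrite /daff /real_pt ?pt0 ?pt1; apply/eqP; rewrite eq_complex /= !(mul0r, mulr0, mul1r, addr0, subr0) !eqxx. Qed.
Lemma daff_ez l b : daff l b ez = ez.
Proof. by apply: C2_ext; rewrite /daff /real_pt ?pt0 ?pt1; apply/eqP; rewrite eq_complex /= !(mul0r, mulr0, mul1r, addr0, subr0) !eqxx. Qed.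
Lemma daff_vfield b u : daff 1 b (vfield u) = vfield (u + b).
Proof. by apply: C2_ext; rewrite /daff /vfield /real_pt ?pt0 ?pt1; apply/eqP; rewrite eq_complex /= !(mul0r, mulr0, mul1r, mulr1, addr0, subr0) !eqxx. Qed.

Lemma Ainv_phi i x : HC_set x ->
  Ainv (aff 1 (ia D 0 i) (ib D 0 i) ((ic D 0 i)%:C%C) x) = Ainv x.
Proof.
move=> Hx; have x0 : 0 < im0 x by [].
rewrite !Ainv_W //; last exact: aff_HC.
rewrite -[RHS](W_phi i) // daff_ez daff_vfield im0_aff im1_aff /= addr0 mul1r.
by congr (W (vfield _) _ _); rewrite mulrDl mulfK // gt_eqF.
Qed.

Lemma Ainv_phi3 x : HC_set x -> Ainv (aff 1 0 0 (kappa%:C%C) x) = Ainv x.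
Proof.
move=> Hx; rewrite !Ainv_W //; last exact: aff_HC.
by rewrite W_phi3 // im0_aff im1_aff /= addr0 mul1r mul0r addr0.
Qed.

Lemma Ainv_continuous x : HC_set x -> {for x, continuous Ainv}.
Proof.
move=> Hx; have x0 : 0 < im0 x by [].
apply: continuousD; first by case: (W_C1 V0 ez Hx).
apply: continuousM; last by case: (W_C1 iz ez Hx).
apply: continuousM; first exact: im1_continuous.
by apply: continuousV; [rewrite gt_eqF|exact: im0_continuous].
Qed.

Lemma q_phi i x : HC_set x -> q (aff 1 (ia D 0 i) (ib D 0 i) ((ic D 0 i)%:C%C) x) = q x.
Proof. by move=> Hx; rewrite -[RHS](W_phi i) // daff_ez daff_iz. Qed.
Lemma q_phi3 x : HC_set x -> q (aff 1 0 0 (kappa%:C%C) x) = q x.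
Proof. exact: W_phi3. Qed.
Lemma q_continuous x : HC_set x -> {for x, continuous q}.
Proof. by move=> /(W_C1 ez iz)[]. Qed.

(** By compactness on the level Im w = 1, which phi_0^n sends to Im w = alpha^n. *)
Lemma q_levels : exists m M : R, [/\ 0 < m, 0 < M &
  forall n x, im0 x = al ^+ n -> chi ^+ n * m <= q x <= chi ^+ n * M].
Proof.
have [x1 [x2 [H1 H2 E]]] := invariant_minmax q_continuous q_phi q_phi3 ltr01 (lexx 1).
exists (q x1), (q x2); split; [exact: W_pos|exact: W_pos|].
elim=> [|n IH] x xn.
  by rewrite expr0 !mul1r; apply: E; rewrite xn expr0 lexx.
pose x' := aff al^-1 0 0 (- it D) x.
have xE : x = aff al 0 0 (it D) x'.
  rewrite /x' aff_comp mulfV ?al_neq0 //.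
  by apply: C2_ext; rewrite /aff ?pt0 ?pt1; ring.
have x'n : im0 x' = al ^+ n.
  by rewrite /x' im0_aff xn exprS mulrA mulVf ?al_neq0 // mul1r.
have Hx' : HC_set x'.
  by rewrite /HC_set /= -/(im0 x') x'n exprn_gt0 // al_gt0.
have -> : q x = chi * q x'.
  by rewrite /q -W_phi0 // daff_ez daff_iz -xE.
by rewrite exprS -!mulrA !ler_pM2l //; exact: IH.
Qed.

Lemma segint_bounds b (f : R -> R) (m M : R) : 0 <= b -> continuous_on_segment 0 b f ->
  (forall s, 0 <= s <= b -> m <= f s <= M) -> m * b <= segint 0 b f <= M * b.
Proof.
move=> b0 cf fmM; have cc (c : R) : continuous_on_segment 0 b (fun=> c).
  by move=> s _; exact: cst_continuous.
have E c : c * b = segint 0 b (fun=> c) by rewrite segint_cst // subr0.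
by rewrite !E; apply/andP; split; apply: le_segint => // s /fmM /andP[].
Qed.

Lemma mass_level n T : 0 < T -> forall m M : R,
  (forall x, im0 x = al ^+ n -> chi ^+ n * m <= q x <= chi ^+ n * M) ->
  (al * chi) ^+ n * m * K * T <= mass T (al ^+ n) <= (al * chi) ^+ n * M * K * T.
Proof.
move=> T0 m M E; have y0 : 0 < al ^+ n by rewrite exprn_gt0 // al_gt0.
set y := al ^+ n in y0 E *.
have cq u : continuous_on_segment 0 K (fun s => yq s (u, y)).
  exact: jointly_continuous_segment (continuous3_joint (p := (u, y)) yq_continuous y0).
have cIG : continuous_on_segment 0 T (fun u => int_yq (u, y)).
  move=> u _; apply: (@continuous_comp _ _ _ (fun u => (u, y)) int_yq).
    exact: (cvg_pair cvg_id (cvg_cst y)).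
  exact: (@segint_param_continuous yq u y yq_continuous y0).
have K0 := K_gt0.
have IGb u : y * chi ^+ n * m * K <= int_yq (u, y) <= y * chi ^+ n * M * K.
  have b s : y * chi ^+ n * m <= yq s (u, y) <= y * chi ^+ n * M.
    by rewrite /yq /= -!mulrA !ler_pM2l // E // im0_real_pt.
  by apply: segint_bounds => //; exact: ltW.
by rewrite exprMn -/y; apply: segint_bounds => //; exact: ltW.
Qed.

(** The mass of the slice between u = 0 and u = T is of the order of
    (alpha chi)^n T at the level alpha^n, and its variation between two levels is
    bounded independently of T. *)
Theorem flux_balance : al * chi = 1.
Proof.
have [m [M [m0 M0 E]]] := q_levels.
have K0 := K_gt0; have al0 := al_gt0 D.
have r0 : 0 < al * chi by rewrite mulr_gt0.
have bnd n : exists C : R, forall T, 0 < T -> `|mass T (al ^+ n) - mass T 1| <= C.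
  have y1 : 1 <= al ^+ n by rewrite exprn_ege1 // ltW // ialpha_gt1.
  have [x1 [x2 [H1 H2 Ab]]] := invariant_minmax Ainv_continuous Ainv_phi Ainv_phi3 ltr01 y1.
  pose a := Num.max `|Ainv x1| `|Ainv x2|.
  have IAb u y : 1 <= y <= al ^+ n -> `|int_A (u, y)| <= a * K.
    move=> yb; have y0 : 0 < y by case/andP: yb => h _; exact: lt_le_trans h.
    have cA : continuous_on_segment 0 K (fun s => A_slice s (u, y)).
      exact: jointly_continuous_segment (continuous3_joint (p := (u, y)) A_slice_continuous y0).
    have : - a * K <= int_A (u, y) <= a * K.
      apply: segint_bounds => //; first exact: ltW.
      move=> s _; rewrite -(Ainv_slice s u y0).
      have /andP[l1 l2] : Ainv x1 <= Ainv (slice s (u, y)) <= Ainv x2.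
        by apply: Ab; rewrite im0_real_pt.
      apply/andP; split.
        rewrite (le_trans _ l1) // lerNl (le_trans (ler_norm _)) // normrN.
        by rewrite /a le_max lexx.
      rewrite (le_trans l2) // (le_trans (ler_norm _)) //.
      by rewrite /a le_max lexx orbT.
    by rewrite ler_norml mulNr.
  exists ((a * K + a * K) * (al ^+ n - 1)) => T T0.
  have pos y : y \in `[1, al ^+ n] -> 0 < y /\ 1 <= y <= al ^+ n.
    by rewrite in_itv /= => /andP[h1 h2]; rewrite h1 h2; split => //; exact: lt_le_trans h1.
  have dH y : y \in `[1, al ^+ n] -> is_derive y 1 (mass T) (- (int_A (T, y) - int_A (0, y))).
    by move=> /pos[y0 _]; exact: mass_derive.
  have dHoo (y : R) : y \in `]1, al ^+ n[ -> is_derive y 1 (mass T) (- (int_A (T, y) - int_A (0, y))).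
    by move=> yI; apply: dH; apply: subset_itv_oo_cc.
  have cH : {within `[1, al ^+ n], continuous (mass T)}.
    apply: continuous_in_subspaceT => y /set_mem /= /dH dHy.
    by apply: differentiable_continuous; apply/derivable1_diffP; exact: ex_derive.
  have [c cI ->] := MVT_segment y1 dHoo cH.
  have [_ cb] := pos c cI.
  rewrite normrM normrN (ger0_norm (_ : 0 <= al ^+ n - 1)) ?subr_ge0 //.
  rewrite ler_wpM2r ?subr_ge0 // (le_trans (ler_normB _ _)) // lerD //; exact: IAb.
have E0 x : im0 x = 1 -> m <= q x <= M.
  by move=> h; have := E 0%N x; rewrite expr0 !mul1r; exact.
have cmp n : (al * chi) ^+ n * m <= M /\ m <= (al * chi) ^+ n * M.
  have [C HC] := bnd n.
  (* divide by T and let T tend to infinity *)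
  have lin (u v : R) : (forall T, 0 < T -> u * K * T <= v * K * T + C) -> u <= v.
    move=> h; rewrite leNgt; apply/negP => vu.
    have d0 : 0 < (u - v) * K by rewrite mulr_gt0 // subr_gt0.
    have C0 : 0 <= `|C| by [].
    have T0 : 0 < (`|C| + 1) / ((u - v) * K) by rewrite divr_gt0 // ltr_wpDl.
    have := h _ T0; set T := _ / _ => hT.
    have TE : T * ((u - v) * K) = `|C| + 1 by rewrite /T divfK // gt_eqF.
    have := ler_norm C; nra.
  have lev0 T : 0 < T -> m * K * T <= mass T 1 <= M * K * T.
    move=> T0; have := @mass_level 0 T T0 m M; rewrite !expr0 !mul1r; apply.
    exact: E0.
  have tri1 (a b c d e : R) : a <= b -> b - c <= e -> c <= d -> a <= d + e by lra.
  have tri2 (a b c d e : R) : a <= b -> - e <= c - b -> c <= d -> a <= d + e by lra.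
  split; apply: lin => T T0; have := HC T T0; rewrite ler_norml => /andP[h1 h2];
    have /andP[h3 h4] := lev0 T T0; have /andP[h5 h6] := mass_level T0 (E n).
    exact: tri1 h5 h2 h4.
  exact: tri2 h3 h1 h6.
(* apply this to alpha chi and to its inverse *)
have geo (r c : R) : 0 < r -> 0 < c -> (forall n, c <= r ^+ n) -> 1 <= r.
  move=> r00 c0 h; rewrite leNgt; apply/negP => r1.
  have /cvgrPdist_lt /(_ _ c0)[N _ /(_ N (leqnn N))] : (fun n => r ^+ n) @ \oo --> (0 : R).
    by apply: cvg_expr; rewrite gtr0_norm.
  by rewrite sub0r normrN gtr0_norm ?exprn_gt0 // ltNge h.
apply/eqP; rewrite eq_le; apply/andP; split.
  rewrite -(invrK (al * chi)) invf_le1 ?invr_gt0 //.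
  apply: (geo _ (m / M)); rewrite ?invr_gt0 ?divr_gt0 // => n.
  rewrite exprVn ler_pdivrMr // mulrC ler_pdivlMr ?exprn_gt0 // mulrC.
  by case: (cmp n).
apply: (geo _ (m / M)); rewrite ?divr_gt0 // => n.
by rewrite ler_pdivrMr //; case: (cmp n).
Qed.

End Flux.

(** * Products, exponentials and constant functions *)

Section LocalCalculus.
Variable R : realType.
Implicit Types (f g : C2 R -> R) (x y u : C2 R).

Lemma C1M f g x : (\forall y \near x, C1_at f y /\ C1_at g y) ->
  C1_at (fun y => f y * g y) x /\
  forall u, real_derive (fun y => f y * g y) x u = f x * real_derive g x u + g x * real_derive f x u.
Proof.
move=> fg.
have D y u : C1_at f y -> C1_at g y ->
    is_derive (0 : R) 1 (real_line (fun y => f y * g y) y u)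
      (f y * real_derive g y u + g y * real_derive f y u).
  move=> [_ /line_is_derive -/(_ u) df _] [_ /line_is_derive -/(_ u) dg _].
  by have := is_deriveM df dg; rewrite /GRing.scale /= /real_line line0.
have [Cf Cg] := nbhs_singleton fg; have [cf df cdf] := Cf; have [cg dg cdg] := Cg.
split; last by move=> u; exact: real_derive_val (D x u Cf Cg).
split; first exact: continuousM.
- by move=> u; exact: (@ex_derive _ _ _ _ _ _ _ (D x u Cf Cg)).
- move=> u; apply: (@near_eq_continuous _ _
      (fun y => f y * real_derive g y u + g y * real_derive f y u)).
    by apply: filterS fg => y [Cfy Cgy]; exact/esym/(real_derive_val (D y u Cfy Cgy)).
  by apply: continuousD; apply: continuousM => //.
Qed.

Lemma C1_expRN f x : (\forall y \near x, C1_at f y) ->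
  C1_at (fun y => expR (- f y)) x /\
  forall u, real_derive (fun y => expR (- f y)) x u = - (expR (- f x) * real_derive f x u).
Proof.
move=> fN.
have cE y : C1_at f y -> {for y, continuous (fun y => expR (- f y))}.
  move=> [cf _ _]; apply: (@continuous_comp _ _ _ (fun y => - f y) (@expR R)).
    exact: continuousN.
  exact: continuous_expR.
have D y u : C1_at f y ->
    is_derive (0 : R) 1 (real_line (fun y => expR (- f y)) y u) (- (expR (- f y) * real_derive f y u)).
  move=> [_ /line_is_derive -/(_ u) df _].
  have dN := is_deriveN df.
  have := @is_derive1_comp R (@expR R) (- real_line f y u) 0 _ _ (is_derive_expR _) dN.
  by rewrite mulrN /real_line /= -[(- _) 0]/(- f (y + _)) line0.
have Cf := nbhs_singleton fN; have [cf df cdf] := Cf.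
split; last by move=> u; exact: real_derive_val (D x u Cf).
split; first exact: cE.
- by move=> u; exact: (@ex_derive _ _ _ _ _ _ _ (D x u Cf)).
- move=> u; apply: (@near_eq_continuous _ _ (fun y => - (expR (- f y) * real_derive f y u))).
    by apply: filterS fN => y Cfy; exact/esym/(real_derive_val (D y u Cfy)).
  by apply: continuousN; apply: continuousM; [exact: cE|exact: cdf].
Qed.

(** The box around x is convex. *)
Lemma locally_cst f x :
  (\forall y \near x, line_derivable f y /\ forall u, real_derive f y u = 0) ->
  \forall y \near x, f y = f x.
Proof.
move=> /nbhs_near_box[d d0 H]; apply/nbhs_near_box; exists d => // y xy.
rewrite -[y in LHS](subrK x) addrC; apply: line_cst => s /andP[s0 s1].
have H' : near_box d x (x + (s%:C%C : Cx R) *: (y - x)).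
  have sub (h : C2 R -> R) : (forall x u (s : R), h (x + (s%:C%C : Cx R) *: u) = h x + s * h u) ->
      `|h x - h y| < d -> `|h x - h (x + (s%:C%C : Cx R) *: (y - x))| < d.
    move=> hE; have hy : h y = h x + h (y - x).
      by have := hE x (y - x) 1; rewrite scale1r mul1r addrC subrK.
    rewrite hE hy !opprD !addrA !subrr !sub0r !normrN => hd.
    rewrite normrM ger0_norm // (le_lt_trans _ hd) //.
    by rewrite ler_piMl.
  have [h1 h2 h3 h4] := xy.
  split; apply: sub => //; [exact: re0_line|exact: im0_line|exact: re1_line|exact: im1_line].
by have [? ?] := H _ H'.
Qed.

(** The universal cover is convex. *)
Lemma HC_cst f x y :
  (forall z, HC_set z -> line_derivable f z /\ forall u, real_derive f z u = 0) ->
  HC_set x -> HC_set y -> f y = f x.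
Proof.
move=> H Hx Hy; rewrite -[y in LHS](subrK x) addrC; apply: line_cst => s /andP[s0 s1].
have [] := H (x + (s%:C%C : Cx R) *: (y - x)) => //.
have x0 : 0 < im0 x by []. have y0 : 0 < im0 y by [].
rewrite /HC_set /= -/(im0 (x + (s%:C%C : Cx R) *: (y - x))) (im0_line x (y - x) s).
have -> : im0 (y - x) = im0 y - im0 x.
  by have := im0_line x (y - x) 1; rewrite scale1r mul1r addrC subrK => ->; rewrite addrAC subrr add0r.
have [->|sn] := eqVneq s 0; first by rewrite mul0r addr0.
have s00 : 0 < s by rewrite lt0r sn.
rewrite (_ : _ + _ = (1 - s) * im0 x + s * im0 y); last by ring.
by rewrite ltr_wpDl ?mulr_gt0 // mulr_ge0 ?subr_ge0 // ltW.
Qed.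

Lemma real_line_aff f l a b t x u :
  real_line (f \o aff l a b t) x u = real_line f (aff l a b t x) (daff l b u).
Proof. by apply/funext => s; rewrite /real_line /= aff_line. Qed.

End LocalCalculus.

(** * Periods of a primitive of the Lee form *)

Section Generators.
Variables (R : realType) (D : inoue_data R).
Local Notation kappa := (inoue_kappa (ia D) (ib D) (ir D)).

Lemma deck_phi0 : deck D (ialpha D) 0 0 (it D).
Proof.
split; first exact: al_gt0.
eexists; first by apply: generated_gen; apply: Or31; reflexivity.
move=> x Hx /=; rewrite toHC_val //.
by apply: C2_ext; rewrite /phi0 /aff ?pt0 ?pt1; ring.
Qed.

Lemma deck_phi i : deck D 1 (ia D 0 i) (ib D 0 i) ((ic D 0 i)%:C%C).
Proof.
split; first exact: ltr01.
eexists; first by apply: generated_gen; apply: Or32; exists i; reflexivity.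
move=> x Hx /=; rewrite toHC_val //.
by apply: C2_ext; rewrite /phi /aff ?pt0 ?pt1; ring.
Qed.

Lemma deck_phi3 : deck D 1 0 0 (kappa%:C%C).
Proof.
split; first exact: ltr01.
eexists; first by apply: generated_gen; apply: Or33; reflexivity.
move=> x Hx /=; rewrite toHC_val //.
by apply: C2_ext; rewrite /phi3 /aff ?pt0 ?pt1; ring.
Qed.

End Generators.

Section Periods.
Variables (R : realType) (D : inoue_data R) (F : C2 R -> R).
Local Notation al := (ialpha D).
Local Notation a1 := (ia D 0 0).
Local Notation a2 := (ia D 0 1).
Local Notation b1 := (ib D 0 0).
Local Notation b2 := (ib D 0 1).
Local Notation kappa := (inoue_kappa (ia D) (ib D) (ir D)).

Definition shift_by l a b t (c : R) := forall x, HC_set x -> F (aff l a b t x) = F x + c.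

Lemma shift_comp l a b t c l' a' b' t' c' : 0 < l' ->
  shift_by l a b t c -> shift_by l' a' b' t' c' ->
  shift_by (l * l') (a + l * a') (b' + b * l') (t + t' + (b * a')%:C%C) (c' + c).
Proof. by move=> l0 h h' x Hx; rewrite -aff_comp h ?h' ?addrA //; exact: aff_HC. Qed.

Lemma shift_cancel l a b t c l' a' b' t' c' : 0 < l' ->
  shift_by l a b t c ->
  shift_by (l * l') (a + l * a') (b' + b * l') (t + t' + (b * a')%:C%C) c' ->
  shift_by l' a' b' t' (c' - c).
Proof.
move=> l0 h h' x Hx; have := h' x Hx; rewrite -aff_comp h ?addrA; last exact: aff_HC.
by move/(canRL (addrK _)) => ->.
Qed.

Lemma shift_uniq l a b t c c' : shift_by l a b t c -> shift_by l a b t c' -> c = c'.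
Proof.
move=> h h'; have Hb := inoue_base R; have := h _ Hb; rewrite h' // => /addrI.
exact: esym.
Qed.

Lemma shift_eq l a b t c l' a' b' t' c' : shift_by l a b t c ->
  l = l' -> a = a' -> b = b' -> t = t' -> c = c' -> shift_by l' a' b' t' c'.
Proof. by move=> h <- <- <- <- <-. Qed.

Lemma Cx_real_add (x y : R) : (x%:C%C : Cx R) + y%:C%C = (x + y)%:C%C.
Proof. by rewrite rmorphD. Qed.

Lemma shift_id : shift_by 1 0 0 0 0.
Proof. by move=> x Hx; rewrite aff1 addr0. Qed.

Variables (h : 'I_2 -> R) (h3 h0 : R).
Hypothesis F_phi : forall i, shift_by 1 (ia D 0 i) (ib D 0 i) ((ic D 0 i)%:C%C) (h i).
Hypothesis F_phi3 : shift_by 1 0 0 (kappa%:C%C) h3.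
Hypothesis F_phi0 : shift_by al 0 0 (it D) h0.

Lemma shift_phiz i (m : int) : shift_by 1 (m%:~R * ia D 0 i) (m%:~R * ib D 0 i)
  ((2^-1 * m%:~R * (m%:~R - 1) * ia D 0 i * ib D 0 i + m%:~R * ic D 0 i)%:C%C) (m%:~R * h i).
Proof.
elim: m => [|m IH|m IH].
- apply: shift_eq shift_id _ _ _ _ _ => //; rewrite ?mul0r //.
  by rewrite mulr0 !mul0r addr0.
- apply: shift_eq (shift_comp ltr01 (F_phi i) IH) _ _ _ _ _; rewrite ?intS; try by ring.
  by rewrite !Cx_real_add; congr (_%:C%C); field.
- apply: shift_eq (shift_cancel (t' := (2^-1 * (- m.+1%:Z)%:~R * ((- m.+1%:Z)%:~R - 1) * ia D 0 i * ib D 0 i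
    + (- m.+1%:Z)%:~R * ic D 0 i)%:C%C)
    (a' := (- m.+1%:Z)%:~R * ia D 0 i) (b' := (- m.+1%:Z)%:~R * ib D 0 i) ltr01 (F_phi i)
    (shift_eq IH _ _ _ _ erefl)) _ _ _ _ _; rewrite ?intS //; try by ring.
  by rewrite !Cx_real_add; congr (_%:C%C); field.
Qed.

Lemma shift_phi3z (m : int) : shift_by 1 0 0 ((kappa * m%:~R)%:C%C) (m%:~R * h3).
Proof.
elim: m => [|m IH|m IH].
- by apply: shift_eq shift_id _ _ _ _ _ => //; rewrite ?mulr0 ?mul0r.
- apply: shift_eq (shift_comp ltr01 F_phi3 IH) _ _ _ _ _; rewrite ?intS; try by ring.
- apply: shift_eq (shift_cancel (t' := (kappa * (- m.+1%:Z)%:~R)%:C%C)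
    (a' := 0) (b' := 0) ltr01 F_phi3
    (shift_eq IH _ _ _ _ erefl)) _ _ _ _ _; rewrite ?intS //; try by ring.
Qed.

Lemma shift_heis (m1 m2 k : int) :
  shift_by 1 (heis_a D m1 m2) (heis_b D m1 m2) ((heis_c D m1 m2 + kappa * k%:~R)%:C%C)
    (m1%:~R * h 0 + m2%:~R * h 1 + k%:~R * h3).
Proof.
have s12 := shift_comp ltr01 (shift_phiz 0 m1) (shift_phiz 1 m2).
apply: shift_eq (shift_comp ltr01 s12 (shift_phi3z k)) _ _ _ _ _;
  rewrite /heis_a /heis_b; try by ring.
by rewrite !Cx_real_add; congr (_%:C%C); rewrite /heis_c; ring.
Qed.

(** The commutator of phi_1 and phi_2 is phi_3^r, with r <> 0. *)
Lemma period3_eq0 : h3 = 0.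
Proof.
have s12 := shift_comp ltr01 (F_phi 0) (F_phi 1).
have s21 := shift_comp ltr01 (F_phi 1) (F_phi 0).
have sr := shift_comp (mulr_gt0 ltr01 ltr01) (shift_phi3z (ir D)) s21.
have /(shift_uniq sr) : shift_by (1 * (1 * 1)) (0 + 1 * (a2 + 1 * a1)) (b1 + b2 * 1 + 0 * (1 * 1))
    ((kappa * (ir D)%:~R)%:C%C + ((ic D 0 1)%:C%C + (ic D 0 0)%:C%C + (b2 * a1)%:C%C)
     + (0 * (a2 + 1 * a1))%:C%C) (h 1 + h 0).
  apply: shift_eq s12 _ _ _ _ _; try by ring.
  rewrite !Cx_real_add; congr (_%:C%C); rewrite [kappa * _]mulrC ir_kappa; ring.
have r0 : (ir D)%:~R != 0 :> R by rewrite intr_eq0 ir_neq0.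
by rewrite [h 0 + h 1]addrC => /(canRL (addKr _)); rewrite addNr => e; apply: (mulfI r0); rewrite mulr0.
Qed.

(** Compare both sides of phi_0 phi_i = phi_1^n_i1 phi_2^n_i2 phi_3^k phi_0. *)
Lemma periods_iN i : h i = (iN D i 0)%:~R * h 0 + (iN D i 1)%:~R * h 1.
Proof.
have s0i := shift_comp ltr01 F_phi0 (F_phi i).
pose k : int := if i == 0 then ip D else iq D.
have si0 := shift_comp (al_gt0 D) (shift_heis (iN D i 0) (iN D i 1) k) F_phi0.
have al0 := al_neq0 D.
have : shift_by (al * 1) (0 + al * ia D 0 i) (ib D 0 i + 0 * 1)
    (it D + (ic D 0 i)%:C%C + (0 * ia D 0 i)%:C%C)
    (h0 + ((iN D i 0)%:~R * h 0 + (iN D i 1)%:~R * h 1 + k%:~R * h3)).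
  apply: shift_eq si0 _ _ _ _ _ => //.
  - by rewrite mulr1 mul1r.
  - by rewrite mulr0 addr0 add0r /heis_a eigen_ia.
  - by rewrite /heis_b eigen_ib mul0r add0r addr0 mulrAC mulVf // mul1r.
  - rewrite mulr0 mul0r addr0 addr0 addrC; congr (_ + _%:C%C).
    rewrite (ic_fixed D i) /inoue_e mxE /heis_c /k.
    by case: (i == 0); ring.
rewrite period3_eq0 mulr0 addr0 => /(shift_uniq s0i); rewrite addrC.
exact: addrI.
Qed.

(** A vector fixed by N is 0: as det N = 1, its determinants with the eigenvectors
    for alpha and 1/alpha are multiplied by alpha and 1/alpha, yet unchanged. *)
Lemma periods_eq0 i : h i = 0.
Proof.
have e0 := periods_iN 0; have e1 := periods_iN 1.
have d1 : (iN D 0 0)%:~R * (iN D 1 1)%:~R - (iN D 0 1)%:~R * (iN D 1 0)%:~R = 1 :> R.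
  by have /(congr1 (intr : int -> R)) := det_iN D; rewrite rmorphB !rmorphM.
have D0 := ia_ib_det_neq0 D.
have al1 := ialpha_gt1 D; have al0 := al_neq0 D.
have det (v : 'rV[R]_2) (c : R) : c != 1 ->
    (forall i, (iN D i 0)%:~R * v 0 0 + (iN D i 1)%:~R * v 0 1 = c * v 0 i) ->
    h 0 * v 0 1 - h 1 * v 0 0 = 0.
  move=> c1 ev; apply/eqP; have : (c - 1) * (h 0 * v 0 1 - h 1 * v 0 0) = 0.
    transitivity (h 0 * (c * v 0 1) - h 1 * (c * v 0 0) - (h 0 * v 0 1 - h 1 * v 0 0)); first by ring.
    have eh (u w : R) : h 0 * u - h 1 * w = ((iN D 0 0)%:~R * h 0 + (iN D 0 1)%:~R * h 1) * u
        - ((iN D 1 0)%:~R * h 0 + (iN D 1 1)%:~R * h 1) * w by rewrite -e0 -e1.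
    rewrite -!ev [X in X - _]eh.
    transitivity (((iN D 0 0)%:~R * (iN D 1 1)%:~R - (iN D 0 1)%:~R * (iN D 1 0)%:~R - 1)
      * (h 0 * v 0 1 - h 1 * v 0 0)); first by ring.
    by rewrite d1 subrr mul0r.
  by move/eqP; rewrite mulf_eq0 subr_eq0 (negPf c1).
have da := det (ia D) al (negbT (gt_eqF al1)) (eigen_ia D).
have db := det (ib D) al^-1 _ (eigen_ib D).
have {}db : h 0 * b2 - h 1 * b1 = 0.
  by apply: db; rewrite lt_eqF // invf_lt1 // al_gt0.
case: i => -[|[|//]] Hi; apply: (mulfI D0); rewrite mulr0.
- rewrite (_ : Ordinal Hi = 0); last exact: val_inj.
  transitivity (b1 * (h 0 * a2 - h 1 * a1) - a1 * (h 0 * b2 - h 1 * b1)); first by ring.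
  by rewrite da db !mulr0 subr0.
- rewrite (_ : Ordinal Hi = 1); last exact: val_inj.
  transitivity (b2 * (h 0 * a2 - h 1 * a1) - a2 * (h 0 * b2 - h 1 * b1)); first by ring.
  by rewrite da db !mulr0 subr0.
Qed.

Lemma shift_phi0z (n : int) : shift_by (al ^ n) 0 0 ((it D : Cx R) *~ n) (n%:~R * h0).
Proof.
have al0 := al_neq0 D.
have aln (m : int) : 0 < al ^ m by rewrite exprz_gt0 // al_gt0.
elim: n => [|n IH|n IH].
- by apply: shift_eq shift_id _ _ _ _ _ => //; rewrite ?mul0r.
- apply: shift_eq (shift_comp (aln _) F_phi0 IH) _ _ _ _ _; rewrite ?intS; try by ring.
    by rewrite (expfzDr _ _ al0) expr1z.
- apply: shift_eq (shift_cancel (l' := al ^ (- n.+1%:Z)) (t' := (it D : Cx R) *~ (- n.+1%:Z))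
    (a' := 0) (b' := 0) (aln _) F_phi0
    (shift_eq IH _ _ _ _ erefl)) _ _ _ _ _; rewrite ?intS //; try by ring.
    by rewrite opprD (expfzDr _ _ al0) mulrA exprN1 mulfV // mul1r.
Qed.

Lemma shift_inoue n a b c : heis_lattice D a b c ->
  shift_by (al ^ n) a (b * al ^ n) (c%:C%C + (it D : Cx R) *~ n) (n%:~R * h0).
Proof.
move=> [m1 [m2 [k [-> -> ->]]]].
have aln : 0 < al ^ n by rewrite exprz_gt0 // al_gt0.
apply: shift_eq (shift_comp aln (shift_heis m1 m2 k) (shift_phi0z n)) _ _ _ _ _.
- by rewrite mul1r.
- by rewrite mulr0 addr0.
- by rewrite add0r.
- by rewrite mulr0 addr0.
- by rewrite !periods_eq0 period3_eq0 !mulr0 !addr0.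
Qed.

End Periods.

(** * The twisted Kaehler form on the universal cover *)

Lemma expRM_intl (R : realType) (n : int) (x : R) : expR (n%:~R * x) = expR x ^ n.
Proof.
case: n => n; first by rewrite -exprnP -expRM_natl.
by rewrite NegzE rmorphN /= mulNr expRN expRM_natl -exprnN.
Qed.

Section Twist.
Variables (R : realType) (D : inoue_data R).
Variables (omega g : tensor2 R (inoue_surface D)) (eta : tensor1 R (inoue_surface D)).
Local Notation A := (inoue_atlas D).
Local Notation pi := (inoue_pi D).
Local Notation kappa := (inoue_kappa (ia D) (ib D) (ir D)).
Hypothesis herm : is_hermitian_metric A g.
Hypothesis omegaE : forall c x u v, A c -> (coord c @` dom c) x ->
  omega c x u v = g c x (Jmul u) v.
Hypothesis Lee : is_Lee_form A omega eta.
Hypothesis primitives : forall p, exists U f, [/\ open U, U p & is_primitive_on A U f eta].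

Let tg := hermitian_tensor herm.
Let teta : is_one_form A eta. Proof. by case: Lee. Qed.

(** The pull-back of omega. It is expressed with the metric, because the tensor
    axioms are given for g and because omega is prescribed only on the charts. *)
Definition form (u v x : C2 R) : R := pullback2 g (Jmul u) v x.
Definition potential : C2 R -> R := primitive (pullback1 eta).

Lemma potential_derive x u : HC_set x ->
  is_derive (0 : R) 1 (real_line potential x u) (pullback1 eta u x).
Proof.
apply: primitive_derive.
- by move=> v y Hy; exact: pullback1_C1.
- by move=> y Hy; exact: pullback1_linear.
- by move=> v w y Hy; apply: pullback1_closed => //; case: Lee.
Qed.

Lemma potential_line_derivable x : HC_set x -> line_derivable potential x.
Proof.
by move=> Hx u; exact: (@ex_derive _ _ _ _ _ _ _ (potential_derive u Hx)).
Qed.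

Lemma potential_real_derive x u : HC_set x -> real_derive potential x u = pullback1 eta u x.
Proof. by move=> Hx; exact: real_derive_val (potential_derive u Hx). Qed.

Lemma primitive_potential U f x : open U -> is_primitive_on A U f eta ->
  HC_set x -> U (pi x) ->
  \forall y \near x, f (pi y) - potential y = f (pi x) - potential x.
Proof.
move=> oU pf Hx Ux; apply: (@locally_cst _ (fun y => f (pi y) - potential y)).
have UN : \forall y \near x, U (pi y).
  by apply: (inoue_pi_continuous Hx); exact: open_nbhs_nbhs.
apply: filterS (filterI (HC_near Hx) UN) => y [Hy Uy].
have [[_ df _] dfE] := pullback1_primitive teta pf oU Hy Uy.
have d u : is_derive (0 : R) 1 (real_line (fun y => f (pi y) - potential y) y u) 0.
  have := is_deriveB (line_is_derive u df) (potential_derive u Hy).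
  by rewrite dfE subrr.
by split=> u; [exact: (@ex_derive _ _ _ _ _ _ _ (d u))|exact: real_derive_val (d u)].
Qed.

(** Continuity comes from the local primitives of eta, from which the potential
    differs by constants. *)
Lemma potential_C1 x : HC_set x -> C1_at potential x.
Proof.
move=> Hx; have [U [f [oU Ux pf]]] := primitives (pi x).
have [cf df cdf] := (pullback1_primitive teta pf oU Hx Ux).1.
split; last 2 first.
- exact: potential_line_derivable.
- move=> u; apply: (@near_eq_continuous _ _ (pullback1 eta u)).
    by apply: filterS (HC_near Hx) => y Hy; rewrite potential_real_derive.
  by case: (pullback1_C1 teta u Hx).
apply: (@near_eq_continuous _ _ (fun y => f (pi y) - (f (pi x) - potential x))).
  apply: filterS (primitive_potential oU pf Hx Ux) => y <-.
  by rewrite opprB addrC subrK.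
by apply: continuousB; [exact: cf|exact: cst_continuous].
Qed.

(** The form eta is invariant, so the potential and its translate have the same
    derivatives. *)
Lemma potential_shift l a b t : deck D l a b t -> exists c, shift_by potential l a b t c.
Proof.
move=> dk; pose p0 : C2 R := pt 'i%C 0; have Hp0 : HC_set p0 by exact: inoue_base.
exists (potential (aff l a b t p0) - potential p0) => x Hx.
apply/eqP; rewrite addrC -subr_eq; apply/eqP.
apply: (@HC_cst _ (fun y => potential (aff l a b t y) - potential y)) => // z Hz.
have d u : is_derive (0 : R) 1
    (real_line (fun y => potential (aff l a b t y) - potential y) z u) 0.
  have d1 := potential_derive (daff l b u) (aff_HC a b t dk.1 Hz).
  rewrite -real_line_aff in d1.
  have := is_deriveB d1 (potential_derive u Hz).
  by rewrite (pullback1_deck teta u dk Hz) (subrr (pullback1 eta u z)).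
by split=> u; [exact: (@ex_derive _ _ _ _ _ _ _ (d u))|exact: real_derive_val (d u)].
Qed.

Lemma Jmul_linear (s : R) (u v : C2 R) :
  Jmul ((s%:C%C : Cx R) *: u + v) = (s%:C%C : Cx R) *: Jmul u + Jmul v.
Proof. by rewrite /Jmul scalerDr !scalerA mulrC. Qed.

Lemma Jmul_daff l b (u : C2 R) : Jmul (daff l b u) = daff l b (Jmul u).
Proof. by apply: C2_ext; rewrite /Jmul /daff !mxE /=; ring. Qed.

Lemma JmulK (u : C2 R) : Jmul (Jmul u) = - u.
Proof.
rewrite /Jmul scalerA (_ : ('i%C : Cx R) * 'i%C = -1) ?scaleN1r //.
by apply/eqP; rewrite eq_complex /=; apply/andP; split; apply/eqP; ring.
Qed.

Lemma form_C1 u v x : HC_set x -> C1_at (form u v) x.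
Proof. exact: pullback2_C1. Qed.

Lemma form_linl v x : HC_set x -> real_linear (fun u => form u v x).
Proof. by move=> Hx s u1 u2; rewrite /form Jmul_linear (pullback2_linearl tg). Qed.

Lemma real_linearN (l : C2 R -> R) u : real_linear l -> l (- u) = - l u.
Proof.
move=> ll; have l0 : l 0 = 0.
  have := ll 1 0 0; rewrite scaler0 addr0 mul1r => /eqP.
  by rewrite -subr_eq subrr => /eqP.
have := ll (-1) u 0; rewrite l0 !addr0 mulN1r => <-.
by rewrite rmorphN rmorph1 scaleN1r.
Qed.

Lemma form_anti u v x : HC_set x -> form u v x = - form v u x.
Proof.
move=> Hx; have [c lc] := lifted_exists D Hx.
rewrite /form !(pullback2E tg _ _ lc).
rewrite -(hermitian_J herm (Jmul u) v lc.1 (lifted_in lc)) JmulK.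
rewrite (real_linearN _ (tensor2_linearl tg (Jmul v) lc.1 (lifted_in lc))).
by rewrite (hermitian_sym herm u (Jmul v) lc.1 (lifted_in lc)).
Qed.

Lemma form_pos x : HC_set x -> 0 < form (real_pt 0 0 1 0) (real_pt 0 0 0 1) x.
Proof.
move=> Hx; have [c lc] := lifted_exists D Hx; rewrite /form (pullback2E tg _ _ lc).
have -> : Jmul (real_pt 0 0 1 0) = real_pt 0 0 0 1 :> C2 R.
  by apply: C2_ext; rewrite /Jmul mxE /real_pt ?pt0 ?pt1; apply/eqP;
    rewrite eq_complex /=; apply/andP; split; apply/eqP; ring.
apply: (hermitian_pos herm lc.1 (lifted_in lc)).
apply/eqP => /(congr1 (fun u : C2 R => im1 u)); rewrite im1_real_pt /im1 mxE /= => /eqP.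
by rewrite oner_eq0.
Qed.

Lemma form_deck l a b t u v x : deck D l a b t -> HC_set x ->
  form (daff l b u) (daff l b v) (aff l a b t x) = form u v x.
Proof. by move=> dk Hx; rewrite /form Jmul_daff (pullback2_deck tg). Qed.

Lemma form_twisted_closed u v w x : HC_set x ->
  real_derive (form v w) x u - real_derive (form u w) x v + real_derive (form u v) x w =
  pullback1 eta u x * form v w x - pullback1 eta v x * form u w x + pullback1 eta w x * form u v x.
Proof.
move=> Hx; have [c lc] := lifted_exists D Hx.
have near_form u' v' : \forall y \near x, form u' v' y = omega c y u' v'.
  apply: filterS (lifted_near lc) => y ly.
  by rewrite /form (pullback2E tg _ _ ly) -omegaE //; [case: ly|exact: lifted_in].
rewrite !(near_eq_real_derive _ (near_form _ _)) !(pullback1E teta _ lc).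
rewrite !(nbhs_singleton (near_form _ _)).
by case: Lee => _ _ /(_ c x u v w lc.1 (lifted_in lc)).
Qed.

(** A closed form, since the differential of omega is eta /\ omega and that of the
    potential is eta. *)
Definition kahler (u v x : C2 R) : R := expR (- potential x) * form u v x.

Lemma expN_C1 x : HC_set x -> C1_at (fun y => expR (- potential y)) x /\
  forall u, real_derive (fun y => expR (- potential y)) x u
            = - (expR (- potential x) * real_derive potential x u).
Proof.
by move=> Hx; apply: C1_expRN; apply: filterS (HC_near Hx) => y; exact: potential_C1.
Qed.

Lemma kahler_C1_derive u v x : HC_set x -> C1_at (kahler u v) x /\
  forall d, real_derive (kahler u v) x d = expR (- potential x) *
    (real_derive (form u v) x d - pullback1 eta d x * form u v x).
Proof.
move=> Hx.
have N : \forall y \near x, C1_at (fun y => expR (- potential y)) y /\ C1_at (form u v) y.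
  by apply: filterS (HC_near Hx) => y Hy; split; [case: (expN_C1 Hy)|exact: form_C1].
have [C dE] := C1M N; split=> // d; rewrite dE.
by rewrite (expN_C1 Hx).2 potential_real_derive //; ring.
Qed.

Lemma kahler_closed u v w x : HC_set x ->
  real_derive (kahler v w) x u - real_derive (kahler u w) x v + real_derive (kahler u v) x w = 0.
Proof.
move=> Hx; have d u' v' := (kahler_C1_derive u' v' Hx).2.
have e := form_twisted_closed u v w Hx.
rewrite !d; transitivity (expR (- potential x) *
  ((real_derive (form v w) x u - real_derive (form u w) x v + real_derive (form u v) x w) -
  (pullback1 eta u x * form v w x - pullback1 eta v x * form u w x + pullback1 eta w x * form u v x))).
  ring.
by rewrite e subrr mulr0.
Qed.

Lemma kahler_shift l a b t c u v x : deck D l a b t -> shift_by potential l a b t c ->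
  HC_set x -> kahler (daff l b u) (daff l b v) (aff l a b t x) = expR (- c) * kahler u v x.
Proof.
by move=> dk sh Hx; rewrite /kahler form_deck // sh // opprD expRD [expR _ * expR _]mulrC mulrA.
Qed.

(** The value of h0 comes from [flux_balance], since phi_0 multiplies [kahler] by
    exp(- h0). *)
Lemma potential_character : exists2 h0 : R, expR h0 = ialpha D &
  forall n a b c, heis_lattice D a b c ->
    shift_by potential (ialpha D ^ n) a (b * ialpha D ^ n)
      (c%:C%C + (it D : Cx R) *~ n) (n%:~R * h0).
Proof.
have [h0 sh0] := potential_shift (deck_phi0 D).
have [h3 sh3] := potential_shift (deck_phi3 D).
have /choice [h sh] : forall i : 'I_2, exists c,
    shift_by potential 1 (ia D 0 i) (ib D 0 i) ((ic D 0 i)%:C%C) c.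
  by move=> i; exact: potential_shift (deck_phi D i).
exists h0; last by move=> n a b c; exact: shift_inoue sh sh3 sh0 n a b c.
have h30 := period3_eq0 sh sh3.
have hi0 i := periods_eq0 sh sh3 sh0 i.
have := @flux_balance R D kahler (expR (- h0)).
have alpha0 := al_neq0 D.
move=> bal; have {}bal : ialpha D * expR (- h0) = 1.
  apply: bal.
  - by move=> u v x Hx; case: (kahler_C1_derive u v Hx).
  - by move=> v x Hx s u1 u2; rewrite /kahler (form_linl v Hx); ring.
  - by move=> u v x Hx; rewrite /kahler (form_anti u v Hx) mulrN.
  - by move=> u v w x; exact: kahler_closed.
  - by move=> x Hx; rewrite /kahler mulr_gt0 ?expR_gt0 // form_pos.
  - move=> i u v x Hx; rewrite (kahler_shift u v (deck_phi D i) (sh i) Hx).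
    by rewrite hi0 oppr0 expR0 mul1r.
  - move=> u v x Hx; have := kahler_shift u v (deck_phi3 D) sh3 Hx.
    by rewrite h30 oppr0 expR0 mul1r !daff1.
  - exact: expR_gt0.
  - by move=> u v x Hx; exact: kahler_shift (deck_phi0 D) sh0 Hx.
by rewrite -[ialpha D]mulr1 -(expRxMexpNx_1 h0) [expR h0 * _]mulrC mulrA bal mul1r.
Qed.

End Twist.

(** * The two line bundles *)

Theorem proposition7p3 (R : realType) (D : inoue_data R)
    (omega' : tensor2 R (inoue_surface D))
    (L' : flat_line_bundle R (inoue_surface D)) :
  is_lck (inoue_atlas D) omega' ->
  is_corresponding_flat (inoue_atlas D) omega' L' ->
  line_bundle_iso (inoue_atlas D) (line_bundle_of_flat L')
    (canonical_bundle (inoue_atlas D)).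
Proof.
move=> [[g herm omegaE] _] [eta [f [lambda [Lee [oU cov] prim flam trans]]]].
have prims p : exists U f, [/\ open U, U p & is_primitive_on (inoue_atlas D) U f eta].
  by have [i Ui] := cov p; exists (fl_dom i), (f i).
have [h0 h0E sh] := potential_character herm omegaE Lee prims.
pose F := potential eta.
pose h (i : fl_index L') (k : {c | inoue_atlas D c}) (p : inoue_surface D) : Cx R :=
  (expR (f i p - F (coord (sval k) p)))%:C%C.
(* the three conditions are: local constancy, non-vanishing, and compatibility
   with the transition functions *)
exists h; split.
- move=> i [k Ak] c p Ac dp [/= Uip dkp].
  have [_ _ cE pE] := Ac; have [Hx pix] := cE _ dp; rewrite pE.
  set x := coord c p in Hx pix *; rewrite -pix in Uip dkp.
  have [gk Gk gkE] := coord_local Ak Hx dkp.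
  have [n [a [b [c0 [Hh gE]]]]] := Gam_inoue_affine Gk.
  apply: near_cst_differentiable.
  have fN := primitive_potential Lee (oU i) (prim i) Hx Uip.
  have hN : \forall y \near x, h i (exist _ k Ak) (inoue_pi D y) =
      (expR (f i (inoue_pi D y) - F y - n%:~R * h0))%:C%C.
    apply: filterS gkE => y [Hy dy cy]; rewrite /h /= cy gE //.
    by rewrite /F (sh n a b c0 Hh y Hy) opprD addrA.
  have hx := nbhs_singleton hN.
  apply: filterS (filterI hN fN) => y [hy fy].
  exact: (etrans hy (etrans (congr1 (fun r => (expR (r - n%:~R * h0))%:C%C : Cx R) fy) (esym hx))).
- move=> i k p _ _; rewrite /h eq_complex /= negb_and.
  by rewrite gt_eqF ?expR_gt0.
- move=> i j [k Ak] [l Al] p Uip Ujp dkp dlp /=.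
  have [_ _ cE pE] := Ak; have [Hx pix] := cE _ dkp.
  rewrite /change pE; set x := coord k p in Hx pix *.
  rewrite -pix in dlp.
  have [gl Gl glE] := coord_local Al Hx dlp.
  have [n [a [b [c0 [Hh gE]]]]] := Gam_inoue_affine Gl.
  have chN : \forall y \near x, (coord l \o inoue_pi D) y = inoue_affine D n a b c0 y.
    by apply: filterS glE => y [Hy _ cy]; rewrite /= cy gE.
  have [_ ->] := near_aff_diff chN.
  have lE : coord l p = inoue_affine D n a b c0 x.
    by have := nbhs_singleton chN; rewrite /= pix.
  have alE : ialpha D ^ n = expR (n%:~R * h0).
    by rewrite -h0E expRM_intl.
  rewrite /h /= /F lE (sh n a b c0 Hh x Hx) alE trans; last by exists p.
  rewrite -(flam i j p Uip Ujp) -!rmorphM -!expRD; congr (expR _)%:C%C.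
  by rewrite -/x; ring.
Qed.
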